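(* Let $(I,\mathbb A,m)$ be a finite measure space with a $(\lambda_1,\lambda_2)$-good grid $\mathcal P$. Suppose $I$ is a quasi-metric space with quasi-distance $d$, such that every $Q\in\mathcal P$ is bounded, there are $\lambda_3,\lambda_4\in(0,1)$ with $$\lambda_3\le\frac{\operatorname{diam}P}{\operatorname{diam}Q}\le\lambda_4\quad\text{whenever }P\subset Q,\ P\in\mathcal P^{k+1},\ Q\in\mathcal P^k,$$ and there are $C\ge0$, $D\ge0$ such that $C^{-D}|Q|\le(\operatorname{diam}Q)^D\le C^D|Q|$ for every $Q\in\mathcal P$. Suppose $p\in[1,\infty)$, $q,\tilde q\in[1,\infty]$, $0<s<1/p$ and $$0<s<\beta<\tilde\beta.$$ Then there is a constant $c>0$ such that for every $Q\in\mathcal P$ $$c\,\mathcal A^h_{s,\tilde\beta,p}(Q)\subset\mathcal A^{bs}_{s,\beta,p,\tilde q}(Q).$$ Moreover there is a constant $c'>0$ such that for every $Q\in\mathcal P$ $$c'\,\mathcal A^h_{s,\beta,p}(Q)\subset\mathcal A^{bs}_{s,\beta,p,\infty}(Q).$$ In particular $$\mathcal B^s_{p,q}=\mathcal B^s_{p,q}(\mathcal A^h_{s,\tilde\beta,p})=\mathcal B^s_{p,q}(\mathcal A^h_{s,\beta,p})$$ and the corresponding norms are equivalent.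
   Context: $|J|=m(J)$; $|\cdot|_p$ is the $L^p(I,\mathbb A,m)$ norm; $\mathbb N=\{0,1,\dots\}$; sup modifications when an exponent is $\infty$; $cX=\{c\phi:\phi\in X\}$. Good grid ($0<\lambda_1<\lambda_2<1$): a sequence $\mathcal P=(\mathcal P^k)_{k\in\mathbb N}$ of finite families of measurable sets of positive measure with: $\mathcal P^0=\{I\}$; $I=\bigcup_{Q\in\mathcal P^k}Q$ up to a null set; the elements of $\mathcal P^k$ are pairwise disjoint; every $Q\in\mathcal P^k$, $k>0$, is contained in some $P\in\mathcal P^{k-1}$; $\lambda_1\le|Q|/|P|\le\lambda_2$ whenever $Q\subset P$, $Q\in\mathcal P^{k+1}$, $P\in\mathcal P^k$; $\bigcup_k\mathcal P^k$ generates $\mathbb A$. Also $\mathcal P$ denotes $\bigcup_k\mathcal P^k$. Given sets $\mathcal A(Q)$, $Q\in\mathcal P$, of functions (''atoms'') vanishing outside $Q$, $\mathcal B^s_{p,q}(\mathcal A)=\mathcal B^s_{p,q}(I,\mathcal P,\mathcal A)$ is the set of complex $g\in L^p$ with $g=\sum_k\sum_{Q\in\mathcal P^k}s_Qa_Q$, $a_Q\in\mathcal A(Q)$, $s_Q\in\mathbb C$, $\sum_k|\sum_{Q\in\mathcal P^k}s_Qa_Q|_p<\infty$, and finite cost $(\sum_k(\sum_{Q\in\mathcal P^k}|s_Q|^p)^{q/p})^{1/q}$; $|g|_{\mathcal B^s_{p,q}(\mathcal A)}$ is the infimum of the costs. $\mathcal A^{sz}_{s,p}(Q)$, the $(s,p)$-Souza's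 atoms on $Q$: functions constant on $Q$, zero outside $Q$, with sup norm $\le|Q|^{s-1/p}$. $\mathcal B^s_{p,q}:=\mathcal B^s_{p,q}(\mathcal A^{sz}_{s,p})$. H\''older atoms: $\mathcal A^h_{s,\beta,p}(Q)$ ($0<s<1/p$, $s<\beta$) is the set of functions $\phi$ vanishing outside $Q$ with $$\sup_{x\ne y\in Q}\frac{|\phi(x)-\phi(y)|}{d(x,y)^{D\beta}}\le|Q|^{s-1/p-\beta},\qquad|\phi|_\infty\le|Q|^{s-1/p}.$$ Besov's atoms: for $Q\in\mathcal P^{k_0}$ let $\mathcal P_Q^i=\{P\in\mathcal P^{k_0+i}:P\subset Q\}$, $\mathcal P_Q=(\mathcal P_Q^i)_{i\ge0}$, and let $\mathcal B^\beta_{p,\tilde q}(Q,\mathcal P_Q,\mathcal A^{sz}_{\beta,p})$ be the set of complex $g\in L^p$ vanishing outside $Q$ that can be written $g=\sum_{i\ge0}\sum_{P\in\mathcal P_Q^i}s_Pa_P$ with $s_P\in\mathbb C$, $a_P\in\mathcal A^{sz}_{\beta,p}(P)$ (i.e. $a_P$ is constant on $P$, zero outside $P$, with sup norm $\le|P|^{\beta-1/p}$), $\sum_i|\sum_{P\in\mathcal P_Q^i}s_Pa_P|_p<\infty$, and finite cost $(\sum_i(\sum_{P\in\mathcal P_Q^i}|s_P|^p)^{\tilde q/p})^{1/\tilde q}$; the norm of $g$ in this space is the infimum of these costs over all such representations. For $s<\beta$, $\tilde q\in[1,\infty]$, $\mathcal A^{bs}_{s,\beta,p,\tilde q}(Q)$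 is the set of $a\in\mathcal B^\beta_{p,\tilde q}(Q,\mathcal P_Q,\mathcal A^{sz}_{\beta,p})$, zero outside $Q$, whose norm in that space is at most $|Q|^{s-\beta}/C_b$, where $C_b=(\sum_{k\ge0}\lambda_2^{k\beta\tilde q})^{1/\tilde q}$ ($=1$ if $\tilde q=\infty$). *)

(* Defs.v *)
From HB Require Import structures.
From mathcomp Require Import all_boot all_order all_algebra.
From mathcomp Require Import all_classical all_reals all_analysis.
From mathcomp Require Import complex.

Set Implicit Arguments.
Unset Strict Implicit.
Unset Printing Implicit Defensive.

Import Order.TTheory GRing.Theory Num.Theory.
Import numFieldNormedType.Exports.

Local Open Scope classical_set_scope.
Local Open Scope ring_scope.

Section QuasiMetric.
Context {R : realType} {T : Type}.

(* Quasi-distance in the sense of Coifman and Weiss: symmetric, with a relaxed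
   triangle inequality. *)
Definition quasi_distance (d : T -> T -> R) : Prop :=
  [/\ forall x y, 0 <= d x y,
      forall x y, d x y = 0 <-> x = y,
      forall x y, d x y = d y x &
      exists K : R, forall x y z, d x z <= K * (d x y + d y z)].

Definition d_bounded (d : T -> T -> R) (A : set T) : Prop :=
  exists M : R, forall x y, A x -> A y -> d x y <= M.

Definition diam (d : T -> T -> R) (A : set T) : R :=
  sup [set r | exists x y, [/\ A x, A y & r = d x y]].

End QuasiMetric.

Section BesovSpaces.
Context {disp : measure_display} {T : measurableType disp} {R : realType}.
Variable m : {finite_measure set T -> \bar R}.
Local Notation C := R[i].

Definition vol (A : set T) : R := fine (m A).

Record good_grid (l1 l2 : R) (P : nat -> set (set T)) : Prop := GoodGrid {
  grid_l1_gt0 : 0 < l1;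
  grid_l1_lt_l2 : l1 < l2;
  grid_l2_lt1 : l2 < 1;
  grid_finite : forall k, finite_set (P k);
  grid_measurable : forall k Q, P k Q -> measurable Q;
  grid_pos : forall k Q, P k Q -> (0 < m Q)%E;
  grid_root : P 0%N = [set setT];
  grid_cover : forall k, m (~` \bigcup_(Q in P k) Q) = 0%E;
  grid_disjoint : forall k, trivIset (P k) id;
  grid_nested : forall k Q, P k.+1 Q -> exists2 W, P k W & Q `<=` W;
  grid_ratio : forall k Q W, P k.+1 Q -> P k W -> Q `<=` W ->
    l1 <= vol Q / vol W <= l2;
  grid_generates : <<s \bigcup_k P k >> = (measurable : set (set T)) }.

(* The integral of a nonnegative function is a supremum over simple functions
   below it, so this also has the right value on functions that are only a.e.
   equal to a measurable one. *)
Definition Lp_norm (p : \bar R) (g : T -> C) : \bar R :=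
  Lnorm m p (fun x => (Normc.normc (g x))%:E).

(* The elements of L^p are represented by functions a.e. equal to a measurable
   one, since atoms defined by pointwise conditions need not be measurable on
   null sets. *)
Definition in_Lp (p : \bar R) (g : T -> C) : Prop :=
  (exists h : T -> C,
     [/\ measurable_fun setT (fun x => complex.Re (h x)),
         measurable_fun setT (fun x => complex.Im (h x)) &
         {ae m, forall x, g x = h x}])
  /\ (Lp_norm p g < +oo)%E.

Section AtomicDecomposition.
(* [X], [P] and [A] are the carrier, the partitions of [X] and the atoms: one
   takes [X := setT] for the global spaces and [X := Q] for the local ones. *)
Variables (X : set T) (P : nat -> set (set T)) (A : set T -> set (T -> C)).
Variables (p : R) (q : \bar R).

Definition level_sum (s : set T -> C) (a : set T -> T -> C) (k : nat) :
  T -> C := fun x => \sum_(Q \in P k) s Q * a Q x.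

Definition atomic_rep (g : T -> C) (s : set T -> C) (a : set T -> T -> C) :
  Prop :=
  [/\ forall k Q, P k Q -> A Q (a Q),
      forall k, in_Lp p%:E (level_sum s a k),
      (\sum_(0 <= k <oo) Lp_norm p%:E (level_sum s a k) < +oo)%E &
      (fun n => Lp_norm p%:E (fun x => g x - \sum_(k < n) level_sum s a k x))
        @ \oo --> 0%E].

(* The l^q norm over the levels k of the l^p norms over the cells of level k;
   for q = +oo it is the supremum over k. *)
Definition cost (s : set T -> C) : \bar R :=
  Lnorm counting q (fun k : nat =>
    ((\sum_(Q \in P k) Normc.normc (s Q) `^ p) `^ p^-1)%:E).

Definition besov : set (T -> C) :=
  [set g | [/\ in_Lp p%:E g, forall x, ~ X x -> g x = 0 &
    exists s a, atomic_rep g s a /\ (cost s < +oo)%E]].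

Definition besov_norm (g : T -> C) : \bar R :=
  ereal_inf [set c | exists s a,
    [/\ atomic_rep g s a, (cost s < +oo)%E & c = cost s]].

End AtomicDecomposition.

Definition souza (s p : R) (Q : set T) : set (T -> C) :=
  [set a | [/\ exists c, forall x, Q x -> a x = c,
               forall x, ~ Q x -> a x = 0 &
               forall x, Normc.normc (a x) <= vol Q `^ (s - p^-1)]].

(* The supremum over x <> y in Q is written as a uniform bound; the bound on phi
   itself is in L^oo, i.e. essential. *)
Definition hoelder_atom (d : T -> T -> R) (D s b p : R) (Q : set T) :
  set (T -> C) :=
  [set phi | [/\ forall x, ~ Q x -> phi x = 0,
     forall x y, Q x -> Q y -> x <> y ->
       Normc.normc (phi x - phi y) / d x y `^ (D * b)
         <= vol Q `^ (s - p^-1 - b) &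
     (Lp_norm +oo phi <= (vol Q `^ (s - p^-1))%:E)%E]].

Definition subgrid (P : nat -> set (set T)) (k0 : nat) (Q : set T) :
  nat -> set (set T) := fun i => [set W | P (k0 + i)%N W /\ W `<=` Q].

Definition besov_const (l2 b : R) (q : \bar R) : \bar R :=
  match q with
  | r%:E => ((\sum_(0 <= k <oo) (l2 `^ (k%:R * b * r))%:E) `^ r^-1)%E
  | _ => 1%E
  end.

(* [k0] is the level of [Q]. *)
Definition besov_atom (P : nat -> set (set T)) (l2 s b p : R) (q : \bar R)
  (k0 : nat) (Q : set T) : set (T -> C) :=
  [set a | besov Q (subgrid P k0 Q) (souza b p) p q a /\
     (besov_norm (subgrid P k0 Q) (souza b p) p q a
        <= (vol Q `^ (s - b))%:E / besov_const l2 b q)%E].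

Definition scale_set (c : R) (X : set (T -> C)) : set (T -> C) :=
  [set (fun x => c%:C%C * phi x) | phi in X].

Definition norms_equivalent (B : set (T -> C)) (N1 N2 : (T -> C) -> \bar R) :
  Prop :=
  exists c1 c2 : R, [/\ 0 < c1, 0 < c2 &
    forall g, B g -> (c1%:E * N1 g <= N2 g <= c2%:E * N1 g)%E].

End BesovSpaces.

(* Main.v *)
Require Import Defs.
From HB Require Import structures.
From mathcomp Require Import all_boot all_order all_algebra finmap.
From mathcomp Require Import all_classical all_reals all_analysis.
From mathcomp Require Import complex measurable_realfun ess_sup_inf.
From mathcomp Require Import ring lra.

Set Implicit Arguments.
Unset Strict Implicit.
Unset Printing Implicit Defensive.

Import Order.TTheory GRing.Theory Num.Theory.
Import numFieldNormedType.Exports.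

Local Open Scope classical_set_scope.
Local Open Scope ring_scope.

(* A Hoelder atom on Q is sampled at one point of each cell; the increment of the
   samples between a cell W and its parent is at most a constant times
   |Q|^(s-1/p-b) |W|^b, because diam(W)^D is comparable to |W|. For a whole
   Hoelder representation g = sum_k L_k the same is done at once for the partial
   sums G_j = L_0 + ... + L_j: on W in P^j the new Souza term has the value
   G_j(x_W) - G_{j-1}(x_{W'}), W' being the parent of W, so that the new partial
   sums telescope. Put u_k = sum_Q |s_Q| |Q|^(-1/p) 1_Q over Q in P^k, whose L^p
   norm is the l^p norm of the coefficients of level k. Both the new values and
   the error G_j - G_j(x_W) are bounded on W by a constant times
   |W|^s sum_(k <= j) theta^(j-k) u_k with theta = l2^(b-s). Minkowski's
   inequality then bounds the new level norms by the convolution of the old ones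
   with the powers of theta, and Young's inequality bounds the cost when b > s.
   A single atom is the case of one nonzero coefficient at level 0 on the grid
   induced on Q, with s replaced by b after multiplication by |Q|^(b-s); for
   equal smoothness theta = 1, but that convolution is still bounded, which gives
   the statement with exponent oo. *)

(** * Convolution with a geometric sequence *)

Section GeometricConvolution.
Context {R : realType}.
Implicit Types (t : R) (B : nat -> R) (r : R).

Definition gconv t B (j : nat) : R := \sum_(k < j.+1) t ^+ (j - k) * B k.

Lemma gconv0 t B : gconv t B 0 = B 0%N.
Proof. by rewrite /gconv big_ord1 subnn expr0 mul1r. Qed.

Lemma gconvS t B j : gconv t B j.+1 = t * gconv t B j + B j.+1.
Proof.
rewrite /gconv big_ord_recr /= subnn expr0 mul1r; congr (_ + _).
rewrite mulr_sumr; apply: eq_bigr => i _.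
by rewrite mulrA -exprS subSn// -ltnS.
Qed.

Lemma gconv_ge0 t B j : 0 <= t -> (forall k, 0 <= B k) -> 0 <= gconv t B j.
Proof. by move=> t0 B0; apply: sumr_ge0 => i _; rewrite mulr_ge0 ?exprn_ge0. Qed.

(** [(1 - t)^-1 * M] is the fixed point of [x |-> t * x + M], so the recursion [gconvS] preserves it
    as an upper bound. This is Young's inequality at exponent oo. *)
Lemma gconv_le t B M j : 0 <= t < 1 -> 0 <= M -> (forall k, B k <= M) ->
  gconv t B j <= (1 - t)^-1 * M.
Proof.
move=> /andP[t0 t1] M0 BM; have t1' : 0 < 1 - t by rewrite subr_gt0.
elim: j => [|j IH].
  rewrite gconv0 (le_trans (BM _))// ler_peMl// invf_ge1// lerBlDr lerDl//.
rewrite gconvS (le_trans (lerD (ler_wpM2l t0 IH) (BM _)))//.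
by rewrite le_eqVlt; apply/orP; left; apply/eqP; field; rewrite gt_eqF.
Qed.

Lemma powR_convex2 t x y r : 0 <= t <= 1 -> 0 <= x -> 0 <= y -> 1 <= r ->
  (t * x + (1 - t) * y) `^ r <= t * x `^ r + (1 - t) * y `^ r.
Proof.
move=> /andP[t0 t1] x0 y0 r1.
by apply: (convex_powR r1 (Itv01 t0 t1)) => /=; rewrite ?inE/= in_itv/= andbT.
Qed.

(* Young's inequality: [gconv t B j.+1] is the convex combination
   [t * gconv t B j + (1 - t) * (B j.+1 / (1 - t))], so convexity of [`^ r] gives
   [S <= t * S + (1 - t) * bound] for the sum [S] of the left-hand side. *)
Lemma sum_powR_gconv t B r N : 0 <= t < 1 -> (forall k, 0 <= B k) -> 1 <= r ->
  \sum_(j < N) gconv t B j `^ r <=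
  (1 - t)^-1 `^ r * \sum_(j < N) B j `^ r.
Proof.
move=> /andP[t0 t1] B0 r1; set d := (1 - t)^-1.
have t1' : 0 < 1 - t by rewrite subr_gt0.
have d0 : 0 <= d by rewrite invr_ge0 ltW.
have r0 : r != 0 by rewrite gt_eqF// (lt_le_trans _ r1).
have t01 : 0 <= t <= 1 by rewrite t0 ltW.
have BE k : B k = (1 - t) * (d * B k) by rewrite mulrA mulfV ?mul1r ?gt_eqF.
have g0 j := gconv_ge0 j t0 B0.
elim: N => [|N IH]; first by rewrite !big_ord0 mulr0.
have step : \sum_(j < N.+1) gconv t B j `^ r <=
    t * \sum_(j < N) gconv t B j `^ r +
    (1 - t) * (d `^ r * \sum_(j < N.+1) B j `^ r).
  (* The term of index 0 is a convex combination whose first entry is 0; the later terms come from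
     [gconvS]. *)
  rewrite !big_ord_recl gconv0 mulrDr mulrDr addrCA lerD//.
    have := powR_convex2 t01 (lexx 0) (mulr_ge0 d0 (B0 0%N)) r1.
    by rewrite mulr0 add0r -BE powR0// mulr0 add0r powRM.
  rewrite !mulr_sumr -big_split/=; apply: ler_sum => j _.
  have := powR_convex2 t01 (g0 j) (mulr_ge0 d0 (B0 j.+1)) r1.
  by rewrite -BE -gconvS powRM.
apply: (le_trans step).
set U := d `^ r * _ in IH; set W := d `^ r * _.
have UW : U <= W.
  by rewrite /U /W ler_wpM2l ?powR_ge0// [leRHS]big_ord_recr/= lerDl powR_ge0.
have := ler_wpM2l t0 IH; have := ler_wpM2l t0 UW.
rewrite -/U; lra.
Qed.

Lemma sum_geometric_le (a z : R) n : 0 <= a -> 0 <= z < 1 ->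
  \sum_(0 <= k < n) a * z ^+ k <= a * (1 - z)^-1.
Proof.
move=> a0 /andP[z0 z1].
have := congr1 (fun f => f n) (geometric_seriesE a (negbT (lt_eqF z1))).
rewrite /series/= => ->; rewrite ler_wpM2r ?invr_ge0 ?subr_ge0 ?(ltW z1)//.
by rewrite ler_piMr// gerBl exprn_ge0.
Qed.

End GeometricConvolution.

(** * Norms of functions that are only almost everywhere measurable *)

Section AlmostEverywhereNorms.
Context {disp : measure_display} {T : measurableType disp} {R : realType}.
Variable m : {measure set T -> \bar R}.
Local Open Scope ereal_scope.
Import HBNNSimple.

(* Neither function is assumed measurable: a simple function below [f] becomes
   one below [h] once it is cut off on the exceptional null set. *)
Lemma ae_le_integral (f h : T -> \bar R) :
  (forall x, 0 <= f x) -> (forall x, 0 <= h x) ->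
  {ae m, forall x, f x <= h x} -> \int[m]_x f x <= \int[m]_x h x.
Proof.
move=> f0 h0 [N [mN N0 fhN]].
rewrite (ge0_integralTE m f0) (ge0_integralTE m h0).
apply/ge_ereal_sup => /= _ [g gf <-].
pose g' := proj_nnsfun g (measurableC mN).
have g'E x : g' x = ((g : T -> R) \_ (~` N)) x.
  by rewrite (mrestrict g (measurableC mN)).
apply: (@le_trans _ _ (sintegral m g')); last first.
  apply: ereal_sup_ubound; exists g' => // x.
  change ((g' x)%:E <= h x); rewrite g'E patchE.
  case: ifPn => [xN|//].
    rewrite (le_trans (gf x))//; apply: contrapT => nfh.
    by move/set_mem : xN => /=; apply; apply: fhN.
rewrite -!integralT_nnsfun le_eqVlt; apply/orP; left; apply/eqP.
apply: ae_eq_integral => //.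
- by apply/measurable_EFinP; exact: measurable_funP.
- by apply/measurable_EFinP; exact: measurable_funP.
exists N; split => // x /= /not_implyP[_] gg'; apply: contrapT => xN; apply: gg'.
by change ((g x)%:E = (g' x)%:E); rewrite g'E patchE mem_set.
Qed.

Lemma ae_le_Lnorm (p : \bar R) (f h : T -> \bar R) : 0 <= p ->
  {ae m, forall x, `|f x| <= `|h x|} -> Lnorm m p f <= Lnorm m p h.
Proof.
rewrite unlock; case: p => [r| |]//=; last first.
  by move=> _ fh; case: ifPn => // m0; exact: le_ess_sup.
rewrite lee_fin => r0 fh.
have inv0 : (0 <= r^-1)%R by rewrite invr_ge0.
apply: gt0_ler_poweR => //.
- by rewrite in_itv/= leey andbT integral_ge0// => x _; exact: poweR_ge0.
- by rewrite in_itv/= leey andbT integral_ge0// => x _; exact: poweR_ge0.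
apply: ae_le_integral => [x|x|]; [exact: poweR_ge0..|].
apply: filterS fh => x fhx.
by apply: gt0_ler_poweR => //; rewrite in_itv/= leey abse_ge0.
Qed.

Lemma LnormZ_EFin (r : R) (c : R) (f : T -> R) : (1 <= r)%R -> (0 <= c)%R ->
  measurable_fun setT f ->
  Lnorm m r%:E (fun x => (c * f x)%:E) = c%:E * Lnorm m r%:E (EFin \o f).
Proof.
move=> r1 c0 mf; rewrite unlock.
have r0 : (0 < r)%R by rewrite (lt_le_trans _ r1).
have mfr : measurable_fun setT (fun x => (`|f x| `^ r)%:E).
  apply/measurable_EFinP; apply: (@measurableT_comp _ _ _ _ _ _ (@powR R ^~ r)) => //.
  exact: measurableT_comp.
transitivity ((\int[m]_x ((c `^ r)%:E * (`|f x| `^ r)%:E)) `^ r^-1).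
  congr (_ `^ _); apply: eq_integral => x _.
  by rewrite /= normrM (ger0_norm c0) powRM.
rewrite ge0_integralZl_EFin ?powR_ge0//.
rewrite poweRM ?lee_fin ?powR_ge0 ?integral_ge0//.
by rewrite poweR_EFin -powRrM mulfV ?gt_eqF// powRr1.
Qed.

(** Minkowski's inequality, by induction on the number of terms; the weights will be the powers of
    [t] in [gconv]. *)
Lemma Lnorm_sum (r : R) n (w : nat -> R) (f : nat -> T -> R) : (1 <= r)%R ->
  (forall k, 0 <= w k)%R -> (forall k, measurable_fun setT (f k)) ->
  Lnorm m r%:E (fun x => (\sum_(k < n) w k * f k x)%:E) <=
  \sum_(k < n) (w k)%:E * Lnorm m r%:E (EFin \o f k).
Proof.
move=> r1 w0 mf; elim: n => [|n IH].
  rewrite big_ord0 (_ : (fun _ => _) = cst 0).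
    by rewrite Lnorm0// eqe gt_eqF// (lt_le_trans _ r1).
  by apply/funext => x; rewrite big_ord0.
rewrite big_ord_recr/= -LnormZ_EFin//.
under [X in Lnorm _ _ X]eq_fun do rewrite big_ord_recr/=.
have := @minkowski_EFin _ _ _ m (fun x => \sum_(k < n) w k * f k x)%R
  (fun x => w n * f n x)%R r.
move=> /(_ _ _ r1) H; apply: (le_trans (H _ _)).
- apply: measurable_sum => k; exact: measurable_funM.
- exact: measurable_funM.
by rewrite leeD2r.
Qed.

End AlmostEverywhereNorms.

(** * Sequence norms over the levels *)

Section CountingNorms.
Context {R : realType}.
Local Open Scope ereal_scope.
Implicit Types (B : nat -> R) (q : \bar R).

Lemma Lnorm_counting_EFin (r : R) B : (0 < r)%R -> (forall k, 0 <= B k)%R ->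
  Lnorm counting r%:E (fun k => (B k)%:E) =
  (\sum_(0 <= k <oo) (B k `^ r)%:E) `^ r^-1.
Proof.
move=> r0 B0; rewrite Lnorm_counting//; congr (_ `^ _).
by apply: eq_eseriesr => k _; rewrite /= ger0_norm.
Qed.

Lemma counting_setT_gt0 : 0 < (@counting nat R) setT.
Proof. by rewrite /counting; case: asboolP => // fin; case: infinite_nat. Qed.

(** Only the empty set is null for counting, so an essential bound over the levels is a bound at
    each level. *)
Lemma ae_counting (Q : nat -> Prop) :
  {ae (@counting nat R), forall k, Q k} -> forall k, Q k.
Proof.
move=> [N [_ N0 QN]] k; apply: contrapT => nQk; have {QN}Nk : N k by exact: QN.
move: N0; rewrite /counting; case: asboolP => // fin [] /eqP.
rewrite pnatr_eq0 cardfs_eq0 => /eqP /(fset_set_set0 fin) N0.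
by rewrite N0 in Nk.
Qed.

(** For finite [q], one term of a nonnegative series is at most its sum. A finite cost thereby
    bounds all levels uniformly, as the convergence part of [hoelder_to_souza] requires. *)
Lemma le_Lnorm_counting q B k : 1 <= q -> (forall i, 0 <= B i)%R ->
  (B k)%:E <= Lnorm counting q (fun i => (B i)%:E).
Proof.
case: q => [r| |]//; last first.
  move=> _ B0; rewrite unlock counting_setT_gt0.
  have /ae_counting/(_ k)/= :=
    @ess_sup_ge _ _ R counting (abse \o (fun i => (B i)%:E)).
  by rewrite ger0_norm.
rewrite lee_fin => r1 B0; have r0 : (0 < r)%R by rewrite (lt_le_trans _ r1).
rewrite Lnorm_counting_EFin//.
have BE : B k = ((B k `^ r) `^ r^-1)%R.
  by rewrite -powRrM mulfV ?gt_eqF// powRr1.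
rewrite BE -poweR_EFin; apply: gt0_ler_poweR.
- by rewrite invr_ge0 ltW.
- by rewrite in_itv/= leey lee_fin powR_ge0.
- rewrite in_itv/= leey andbT nneseries_ge0// => n _ _.
  by rewrite lee_fin powR_ge0.
apply: le_trans (nneseries_lim_ge k.+1 _); last first.
  by move=> n _ _; rewrite lee_fin powR_ge0.
by rewrite big_nat_recr//= leeDr// sume_ge0// => i _; rewrite lee_fin powR_ge0.
Qed.

(** Young's inequality for a geometric kernel: [gconv_le] covers [q = +oo], and for finite [q] the
    bound of [sum_powR_gconv] on partial sums passes to the limit. *)
Lemma Lnorm_gconv_le q t K (A B : nat -> R) : 1 <= q -> (0 <= t < 1)%R ->
  (0 <= K)%R -> (forall k, 0 <= A k)%R -> (forall k, 0 <= B k)%R ->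
  (forall k, A k <= K * gconv t B k)%R ->
  Lnorm counting q (fun k => (A k)%:E) <=
  (K * (1 - t)^-1)%:E * Lnorm counting q (fun k => (B k)%:E).
Proof.
move=> q1 t01 K0 A0 B0 AB; have /andP[t0 t1] := t01.
have t1' : (0 < (1 - t)^-1)%R by rewrite invr_gt0 subr_gt0.
case: q q1 => [r| |]//; last first.
  move=> _; have [BM|] := boolP (Lnorm counting +oo (fun k => (B k)%:E) \is a fin_num).
    rewrite -(fineK BM); set M := fine _.
    have BleM k : (B k <= M)%R.
      by rewrite -lee_fin /M fineK// le_Lnorm_counting// leey.
    have M0 : (0 <= M)%R by rewrite (le_trans (B0 0%N)).
    rewrite unlock counting_setT_gt0; apply/ess_supP/aeW => k /=.
    rewrite ger0_norm// -EFinM lee_fin (le_trans (AB k))// -mulrA ler_wpM2l//.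
    exact: gconv_le.
  rewrite ge0_fin_numE ?Lnorm_ge0// -leNgt leye_eq => /eqP BE.
  (* The product [0 * +oo] is 0, so for [K = 0] the claim has to come from [A k <= 0]. *)
  move: K0; rewrite le_eqVlt => /predU1P[K0|K0].
    rewrite -K0 mul0r mul0e unlock counting_setT_gt0; apply/ess_supP/aeW => k /=.
    by rewrite ger0_norm// lee_fin (le_trans (AB k))// -K0 mul0r.
  by rewrite BE gt0_muley ?leey// lte_fin mulr_gt0.
rewrite lee_fin => r1; have r0 : (0 < r)%R by rewrite (lt_le_trans _ r1).
have Kd0 : (0 <= K * (1 - t)^-1)%R by rewrite mulr_ge0// ltW.
rewrite !Lnorm_counting_EFin//.
have S0 (C : nat -> R) : 0 <= \sum_(0 <= k <oo) (C k `^ r)%:E.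
  by rewrite nneseries_ge0// => n _ _; rewrite lee_fin powR_ge0.
have KE : (K * (1 - t)^-1 = ((K * (1 - t)^-1) `^ r) `^ r^-1)%R.
  by rewrite -powRrM mulfV ?gt_eqF// powRr1.
rewrite KE -poweR_EFin -poweRM ?lee_fin ?powR_ge0//.
apply: gt0_ler_poweR; first by rewrite invr_ge0 ltW.
- by rewrite in_itv/= leey andbT S0.
- by rewrite in_itv/= leey andbT mule_ge0// lee_fin powR_ge0.
apply: lime_le; first by apply: is_cvg_nneseries => n _ _; rewrite lee_fin powR_ge0.
apply: nearW => n.
apply: (@le_trans _ _ (((K * (1 - t)^-1) `^ r)%:E * \sum_(0 <= k < n) (B k `^ r)%:E)).
  rewrite !big_mkord !sumEFin -EFinM lee_fin powRM// ?(ltW t1')//.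
  rewrite -mulrA.
  apply: le_trans (ler_wpM2l (powR_ge0 _ _) (sum_powR_gconv n t01 B0 r1)).
  rewrite mulr_sumr ler_sum// => k _; rewrite -powRM ?gconv_ge0//.
  by apply: ge0_ler_powR; rewrite ?nnegrE ?mulr_ge0 ?gconv_ge0// ltW.
rewrite lee_wpmul2l ?lee_fin ?powR_ge0//.
by apply: nneseries_lim_ge => k _ _; rewrite lee_fin powR_ge0.
Qed.

Lemma Lnorm_counting_root_le q (c : R) : 1 <= q -> (0 <= c)%R ->
  Lnorm counting q (fun k => (if k is 0%N then c else 0%R)%:E) <= c%:E.
Proof.
case: q => [r| |]// + c0; last first.
  move=> _; rewrite unlock counting_setT_gt0; apply/ess_supP/aeW => -[|k] /=.
    by rewrite ger0_norm.
  by rewrite normr0 lee_fin.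
rewrite lee_fin => r1; have r0 : (0 < r)%R by rewrite (lt_le_trans _ r1).
rewrite Lnorm_counting_EFin//; last by case.
have cE : c = ((c `^ r) `^ r^-1)%R by rewrite -powRrM mulfV ?gt_eqF// powRr1.
rewrite [leRHS](_ : _ = (c `^ r)%:E `^ r^-1); last by rewrite poweR_EFin -cE.
apply: gt0_ler_poweR; first by rewrite invr_ge0 ltW.
- rewrite in_itv/= leey andbT nneseries_ge0// => n _ _.
  by rewrite lee_fin powR_ge0.
- by rewrite in_itv/= leey lee_fin powR_ge0.
apply: lime_le; first by apply: is_cvg_nneseries => n _ _; rewrite lee_fin powR_ge0.
apply: nearW => -[|n]; first by rewrite big_nil lee_fin powR_ge0.
rewrite big_nat_recl// big1 ?adde0// => k _.
by rewrite powR0// gt_eqF.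
Qed.

End CountingNorms.

Lemma besov_const_gt0 {R : realType} (l b : R) (q : \bar R) : 0 < l < 1 -> 0 < b ->
  (1 <= q)%E -> exists2 r, 0 < r & besov_const l b q = r%:E.
Proof.
move=> /andP[l0 l1] b0; case: q => [r| |]//; last by move=> _; exists 1.
rewrite lee_fin => r1; have r0 : 0 < r by rewrite (lt_le_trans _ r1).
rewrite /besov_const; set S := limn _.
have z1 : l `^ (b * r) < 1.
  have -> : 1 = 1 `^ (b * r) :> R by rewrite powR1.
  by apply: gt0_ltr_powR; rewrite ?nnegrE// ?mulr_gt0// ltW.
have zE k : l `^ (k%:R * b * r) = l `^ (b * r) ^+ k.
  have -> : k%:R * b * r = b * r * k%:R by ring.
  by rewrite (powRrM _ (b * r)) powR_mulrn// powR_ge0.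
have S1 : (1%:E <= S)%E.
  apply: le_trans (nneseries_lim_ge 1 _); last first.
    by move=> n _ _; rewrite lee_fin powR_ge0.
  by rewrite big_nat1 mul0r mul0r powRr0.
have Sy : (S < +oo)%E.
  apply: (@le_lt_trans _ _ ((1 - l `^ (b * r))^-1)%:E); last exact: ltry.
  apply: lime_le; first by apply: is_cvg_nneseries => n _ _; rewrite lee_fin powR_ge0.
  apply: nearW => n; rewrite sumEFin lee_fin.
  under eq_bigr do rewrite zE -[_ ^+ _]mul1r.
  by rewrite -[leRHS]mul1r sum_geometric_le// powR_ge0.
case: S S1 Sy => [x| |]// x1 _.
exists (x `^ r^-1); last by rewrite poweR_EFin.
by rewrite powR_gt0// (lt_le_trans (@ltr01 R))// -lee_fin.
Qed.

(** * Complex moduli and measurability almost everywhere *)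

Section ComplexNorm.
Context {R : realType}.
Local Notation normc := (@Normc.normc R).
Implicit Types x y : R[i].

Lemma normc_ge0 x : 0 <= normc x.
Proof. by case: x => a b; exact: sqrtr_ge0. Qed.

Lemma normc_real (r : R) : normc r%:C%C = `|r|.
Proof. by rewrite /= expr0n/= addr0 sqrtr_sqr. Qed.

Lemma normc_Re_le x : `|complex.Re x| <= normc x.
Proof. by case: x => a b /=; rewrite -sqrtr_sqr ler_sqrt ?lerDl ?addr_ge0 ?sqr_ge0. Qed.

Lemma normc_Im_le x : `|complex.Im x| <= normc x.
Proof. by case: x => a b /=; rewrite -sqrtr_sqr ler_sqrt ?lerDr ?addr_ge0 ?sqr_ge0. Qed.

Lemma normc_sum_le n (F : nat -> R[i]) :
  normc (\sum_(k < n) F k) <= \sum_(k < n) normc (F k).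
Proof.
elim: n => [|n IH]; first by rewrite !big_ord0 Normc.normc0.
by rewrite !big_ord_recr/= (le_trans (le_normcD _ _))// lerD2r.
Qed.

Lemma ReD x y : complex.Re (x + y) = complex.Re x + complex.Re y.
Proof. by case: x y => [a b] [c d]. Qed.

Lemma ImD x y : complex.Im (x + y) = complex.Im x + complex.Im y.
Proof. by case: x y => [a b] [c d]. Qed.

Lemma ReN x : complex.Re (- x) = - complex.Re x.
Proof. by case: x. Qed.

Lemma ImN x : complex.Im (- x) = - complex.Im x.
Proof. by case: x. Qed.

End ComplexNorm.

Section AeMeasurable.
Context {disp : measure_display} {T : measurableType disp} {R : realType}.
Variable m : {finite_measure set T -> \bar R}.
Local Notation normc := (@Normc.normc R).
Implicit Types (f g : T -> R[i]) (p : R).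

Definition ae_measurable f : Prop :=
  exists h : T -> R[i],
     [/\ measurable_fun setT (fun x => complex.Re (h x)),
         measurable_fun setT (fun x => complex.Im (h x)) &
         {ae m, forall x, f x = h x}].

Lemma ae_measurableD f g :
  ae_measurable f -> ae_measurable g -> ae_measurable (fun x => f x + g x).
Proof.
move=> [f' [fR fI ff]] [g' [gR gI gg]]; exists (fun x => f' x + g' x); split.
- by under eq_fun do rewrite ReD; exact: measurable_funD.
- by under eq_fun do rewrite ImD; exact: measurable_funD.
- by apply: filterS2 ff gg => x -> ->.
Qed.

Lemma ae_measurableN f : ae_measurable f -> ae_measurable (fun x => - f x).
Proof.
move=> [f' [fR fI ff]]; exists (fun x => - f' x); split.
- by under eq_fun do rewrite ReN; exact: measurableT_comp.
- by under eq_fun do rewrite ImN; exact: measurableT_comp.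
- by apply: filterS ff => x ->.
Qed.

Lemma ae_measurable_sum (F : nat -> T -> R[i]) n :
  (forall k, ae_measurable (F k)) -> ae_measurable (fun x => \sum_(k < n) F k x).
Proof.
move=> mF; elim: n => [|n IH].
  exists (fun => 0); split => //=.
  by apply: aeW => x; rewrite big_ord0.
under eq_fun do rewrite big_ord_recr/=.
exact: ae_measurableD.
Qed.

Lemma measurable_normc f : measurable_fun setT (fun x => complex.Re (f x)) ->
  measurable_fun setT (fun x => complex.Im (f x)) ->
  measurable_fun setT (fun x => normc (f x)).
Proof.
move=> fR fI.
have -> : (fun x => normc (f x)) =
    (fun x => (complex.Re (f x) ^+ 2 + complex.Im (f x) ^+ 2) `^ 2^-1).
  apply/funext => x; rewrite powR12_sqrt ?addr_ge0 ?sqr_ge0//.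
  by case: (f x).
apply: (@measurableT_comp _ _ _ _ _ _ (@powR R ^~ 2^-1)) => //.
by apply: measurable_funD; exact: measurable_funX.
Qed.

Lemma Lp_norm_le p f (h : T -> R) : 0 <= p ->
  {ae m, forall x, normc (f x) <= h x} ->
  (Lp_norm m p%:E f <= Lnorm m p%:E (EFin \o h))%E.
Proof.
move=> p0 fh; apply: ae_le_Lnorm => //; apply: filterS fh => x fhx /=.
by rewrite lee_fin ger0_norm ?normc_ge0// (le_trans fhx)// ler_norm.
Qed.

(** Minkowski's inequality is applied to the moduli of measurable representatives, which leaves the
    norms unchanged. *)
Lemma Lp_normD p f g : 1 <= p -> ae_measurable f -> ae_measurable g ->
  (Lp_norm m p%:E (fun x => f x + g x)%R <= Lp_norm m p%:E f + Lp_norm m p%:E g)%E.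
Proof.
move=> p1 [f' [fR fI ff]] [g' [gR gI gg]].
have p0 : 0 <= p by rewrite (le_trans _ p1).
pose F x := normc (f' x); pose G x := normc (g' x).
apply: (@le_trans _ _ (Lnorm m p%:E (EFin \o (F \+ G)%R))%E).
  by apply: Lp_norm_le => //; apply: filterS2 ff gg => x -> ->; exact: le_normcD.
apply: (le_trans (minkowski_EFin _ _ _ p1)); [exact: measurable_normc..|].
apply: leeD; apply: ae_le_Lnorm => //.
  by apply: filterS ff => x ->.
by apply: filterS gg => x ->.
Qed.

Lemma in_LpZ p f (c : R) : 1 <= p -> 0 <= c -> in_Lp m p%:E f ->
  in_Lp m p%:E (fun x => c%:C%C * f x).
Proof.
move=> p1 c0 [[h [hR hI fh]] fy].
have p0 : 0 <= p by rewrite (le_trans _ p1).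
have mh := measurable_normc hR hI.
split; last first.
  apply: (@le_lt_trans _ _ (c%:E * Lp_norm m p%:E f)%E).
    apply: (@le_trans _ _ (Lnorm m p%:E (fun x => (c * normc (h x))%:E))).
      apply: Lp_norm_le => //; apply: filterS fh => x ->.
      by rewrite Normc.normcM normc_real ger0_norm.
    rewrite LnormZ_EFin// lee_wpmul2l ?lee_fin//.
    by apply: ae_le_Lnorm => //; apply: filterS fh => x ->.
  by rewrite lte_mul_pinfty ?lee_fin.
exists (fun x => c%:C%C * h x); split.
- have -> : (fun x => complex.Re (c%:C%C * h x)) = (fun x => c * complex.Re (h x)).
    by apply/funext => x; case: (h x) => u v /=; rewrite mul0r subr0.
  exact: measurable_funM.
- have -> : (fun x => complex.Im (c%:C%C * h x)) = (fun x => c * complex.Im (h x)).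
    by apply/funext => x; case: (h x) => u v /=; rewrite mul0r addr0.
  exact: measurable_funM.
- by apply: filterS fh => x ->.
Qed.

(** Putting the value 0 on the exceptional null set turns convergence almost everywhere into
    convergence everywhere, so that real and imaginary parts are pointwise limits of measurable
    functions. *)
Lemma ae_measurable_lim f (F : nat -> T -> R[i]) :
  (forall n, measurable_fun setT (fun x => complex.Re (F n x))) ->
  (forall n, measurable_fun setT (fun x => complex.Im (F n x))) ->
  {ae m, forall x, (fun n => normc (F n x - f x)) @ \oo --> 0} ->
  ae_measurable f.
Proof.
move=> mR mI [N [mN N0 FN]].
have FN' x : ~ N x -> (fun n => normc (F n x - f x)) @ \oo --> 0.
  by move=> Nx; apply: contrapT => H; apply: Nx; exact: FN.
have H (pr : R[i] -> R) :
    (forall x y, pr (x + y) = pr x + pr y) -> (forall x, pr (- x) = - pr x) ->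
    pr 0 = 0 -> (forall x, `|pr x| <= normc x) ->
    (forall n, measurable_fun setT (fun x => pr (F n x))) ->
    measurable_fun setT (fun x => pr (if x \in N then 0 else f x)).
  move=> prD prN pr0 prle mpr.
  apply: (@measurable_fun_cvg _ _ _ setT
    (fun n x => \1_(~` N) x * pr (F n x))).
    move=> n; apply: measurable_funM => //; apply: measurable_indic.
    exact: measurableC.
  move=> x _; case: ifPn => xN.
    rewrite pr0; have -> : \1_(~` N) x = 0 :> R.
      by rewrite indicE memNset//= => /(_ (set_mem xN)).
    under eq_cvg do rewrite mul0r; exact: cvg_cst.
  have Nx : ~ N x by move=> /mem_set; rewrite (negbTE xN).
  have -> : \1_(~` N) x = 1 :> R by rewrite indicE mem_set.
  under eq_cvg do rewrite mul1r.
  apply/subr_cvg0; apply: norm_cvg0; apply: (squeeze_cvgr _ (cvg_cst 0) (FN' x Nx)).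
  apply: nearW => n; rewrite normr_ge0/=.
  by rewrite -prN -prD.
exists (fun x => if x \in N then 0 else f x); split.
- by apply: H => //; [exact: ReD|exact: ReN|exact: normc_Re_le].
- by apply: H => //; [exact: ImD|exact: ImN|exact: normc_Im_le].
exists N; split => // x /= fx; apply: contrapT => Nx; apply: fx.
by rewrite memNset.
Qed.

End AeMeasurable.

(** * Nested cells and step functions *)

Section Cells.
Context {disp : measure_display} {T : measurableType disp} {R : realType}.
Variable m : {finite_measure set T -> \bar R}.
Local Notation normc := (@Normc.normc R).

(* What is used of a good grid, on a carrier [X] that is either the whole space
   or, for the grid induced by a cell, that cell. *)
Record cells (l1 l2 : R) (X : set T) (P : nat -> set (set T)) : Prop := Cells {
  cells_l1 : 0 < l1 <= 1;
  cells_l2 : 0 < l2 < 1;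
  cells_finite : forall k, finite_set (P k);
  cells_measurable : forall k Q, P k Q -> measurable Q;
  cells_gt0 : forall k Q, P k Q -> 0 < vol m Q;
  cells_root : P 0%N = [set X];
  cells_cover : forall k, m (X `\` \bigcup_(Q in P k) Q) = 0%E;
  cells_eq : forall k Q W x, P k Q -> P k W -> Q x -> W x -> Q = W;
  cells_parent : forall k Q, P k.+1 Q -> exists W,
    [/\ P k W, Q `<=` W, l1 * vol m W <= vol m Q & vol m Q <= l2 * vol m W] }.

Variables (l1 l2 : R) (X : set T) (P : nat -> set (set T)).
Hypothesis hG : cells l1 l2 X P.

Let l20 : 0 < l2. Proof. by case/andP: (cells_l2 hG). Qed.
Let l21 : l2 < 1. Proof. by case/andP: (cells_l2 hG). Qed.

Lemma cells_ne k Q : P k Q -> exists x, Q x.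
Proof.
move=> PQ; apply: contrapT => H; have := cells_gt0 hG PQ.
suff -> : Q = set0 by rewrite /vol measure0 ltxx.
by apply/seteqP; split => // x Qx; apply: H; exists x.
Qed.

(** Iterates [cells_parent]; the factor [l2 ^+ i] is the source of the geometric rates below. *)
Lemma cells_anc k i W : P (k + i)%N W ->
  exists Q, [/\ P k Q, W `<=` Q & vol m W <= l2 ^+ i * vol m Q].
Proof.
elim: i W => [|i IH] W; first by rewrite addn0 => PW; exists W; split=> //; rewrite expr0 mul1r.
rewrite addnS => /(cells_parent hG)[V [/IH[Q [PQ VQ vVQ]] WV _ vWV]].
exists Q; split => //; first exact: subset_trans VQ.
by rewrite (le_trans vWV)// exprS -mulrA ler_wpM2l// ltW.
Qed.

Lemma cells_sub k Q : P k Q -> Q `<=` X /\ vol m Q <= l2 ^+ k * vol m X.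
Proof.
move=> PQ; have [V [PV QV vQV]] := @cells_anc 0 k Q PQ.
by move: PV; rewrite (cells_root hG) /= => VX; rewrite -VX.
Qed.

(* Coefficients and atoms are indexed by sets rather than by pairs of a level and
   a set, so the level of a cell has to be recovered from the cell. *)
Lemma cells_level_uniq j k Q : P j Q -> P k Q -> j = k.
Proof.
wlog jk : j k / (j <= k)%N.
  by move=> H Pj Pk; have [jk|/ltnW kj] := leqP j k; [exact: H|exact/esym/H].
move=> Pj; rewrite -(subnKC jk); case: (k - j)%N => [|i]; first by rewrite addn0.
move=> Pk; have [W [PW QW vQW]] := cells_anc Pk.
have [x Qx] := cells_ne Pj.
have QWE := cells_eq hG Pj PW Qx (QW _ Qx).
move: vQW; rewrite -QWE leNgt => /negP[].
rewrite -[ltRHS]mul1r ltr_pM2r ?(cells_gt0 hG Pj)//.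
by rewrite exprn_ilt1// ltW.
Qed.

(** Disjointness of the cells of one level leaves [W] as the only term that can be nonzero at
    [x]. *)
Lemma fsbig_cell (V : nmodType) (F : set T -> V) k W x : P k W -> W x ->
  (forall Q, P k Q -> ~ Q x -> F Q = 0) -> \sum_(Q \in P k) F Q = F W.
Proof.
move=> PW Wx F0; rewrite -(fsbig_widen [set W] (P k)); first exact: fsbig_set1.
  by move=> _ ->.
move=> Q [PQ /= QW]; apply: F0 => // Qx; apply: QW.
exact: (cells_eq hG PQ PW Qx Wx).
Qed.

(** One null set has to serve all levels: it is the countable union of what the single levels leave
    uncovered. *)
Lemma ae_cells :
  {ae m, forall x, X x -> forall k, exists2 W, P k W & W x}.
Proof.
have mX : measurable X by apply: (cells_measurable hG (k := 0)); rewrite (cells_root hG).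
have H k : {ae m, forall x, X x -> exists2 W, P k W & W x}.
  exists (X `\` \bigcup_(Q in P k) Q); split.
  - apply: measurableD => //; apply: fin_bigcup_measurable.
      exact: (cells_finite hG).
    by move=> Q; exact: (cells_measurable hG).
  - exact: (cells_cover hG).
  - by move=> x /not_implyP[Xx nW]; split => // -[W PW Wx]; apply: nW; exists W.
have /ae_foralln := H; apply: filterS => x Hx Xx k; exact: Hx.
Qed.

Definition step (k : nat) (c : set T -> R) : T -> R :=
  fun x => \sum_(Q \in P k) c Q * \1_Q x.

Lemma step_in k c W x : P k W -> W x -> step k c x = c W.
Proof.
move=> PW Wx; rewrite /step (fsbig_cell PW Wx); first by rewrite indicE mem_set// mulr1.
by move=> Q PQ Qx; rewrite indicE memNset// mulr0.
Qed.

Lemma step_out k c x : (forall W, P k W -> ~ W x) -> step k c x = 0.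
Proof.
by move=> H; apply: fsbig1 => Q PQ; rewrite indicE memNset ?mulr0//; exact: H.
Qed.

Lemma step_ge0 k c x : (forall Q, 0 <= c Q) -> 0 <= step k c x.
Proof. by move=> c0; apply: fsumr_ge0 => Q _; rewrite mulr_ge0. Qed.

(** The lemmas on finite sums of measurable functions ask for measurability of every summand, also
    at sets that are not cells; [h] is therefore made 0 at nonmeasurable sets. *)
Let stepE k c : exists h : set T -> T -> R, [/\
  forall Q, measurable_fun setT (h Q),
  forall x, step k c x = \sum_(Q <- fset_set (P k)) h Q x,
  forall Q x, (forall W, 0 <= c W) -> 0 <= h Q x &
  forall Q, P k Q -> h Q = fun x => c Q * \1_Q x].
Proof.
exists (fun Q x => if pselect (measurable Q) then c Q * \1_Q x else 0); split.
- move=> Q; case: pselect => [mQ|_] /=; last exact: measurable_cst.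
  by apply: measurable_funM => //; exact: measurable_indic.
- move=> x; rewrite /step fsbig_finite; last exact: (cells_finite hG).
  apply: eq_big_seq => Q; rewrite in_fset_set; last exact: (cells_finite hG).
  by move=> /set_mem PQ; case: pselect => // -[]; exact: (cells_measurable hG PQ).
- by move=> Q x c0; case: pselect => [mQ|_] //=; rewrite mulr_ge0.
- move=> Q PQ; apply/funext => x.
  by case: pselect => // -[]; exact: (cells_measurable hG PQ).
Qed.

Lemma measurable_step k c : measurable_fun setT (step k c).
Proof.
have [h [mh hE _ _]] := stepE k c; rewrite (funext hE).
exact: measurable_sum.
Qed.

Lemma integral_step k c : (forall Q, 0 <= c Q) ->
  (\int[m]_x (step k c x)%:E = (\sum_(Q \in P k) c Q * vol m Q)%:E)%E.
Proof.
move=> c0; have [h [mh hE h0 hQ]] := stepE k c.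
have fin := cells_finite hG k.
rewrite fsbig_finite// -sumEFin.
under eq_integral do rewrite hE -sumEFin.
rewrite ge0_integral_sum//; last 2 first.
- by move=> Q; exact/measurable_EFinP.
- by move=> Q x _; rewrite lee_fin h0.
apply: eq_big_seq => Q; rewrite in_fset_set// => /set_mem PQ.
have mQ := cells_measurable hG PQ.
rewrite (hQ _ PQ); under eq_integral do rewrite EFinM.
rewrite ge0_integralZl_EFin//; last exact/measurable_EFinP/measurable_indic.
by rewrite integral_indic// setIT EFinM /vol fineK// fin_num_measure.
Qed.

Definition lpn (p : R) (k : nat) (c : set T -> R) : R :=
  (\sum_(Q \in P k) c Q `^ p) `^ p^-1.

Lemma lpn_ge0 p k c : 0 <= lpn p k c.
Proof. exact: powR_ge0. Qed.

Lemma Lnorm_step p k (c : set T -> R) : 1 <= p -> (forall Q, 0 <= c Q) ->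
  (Lnorm m p%:E (EFin \o step k (fun Q => c Q * vol m Q `^ (- p^-1))%R)
    = (lpn p k c)%:E)%E.
Proof.
move=> p1 c0; have p0 : 0 < p by rewrite (lt_le_trans _ p1).
rewrite unlock /lpn -poweR_EFin; congr (_ `^ _)%E.
pose c' Q := c Q * vol m Q `^ (- p^-1); have c'0 Q : 0 <= c' Q by rewrite mulr_ge0 ?powR_ge0.
transitivity (\int[m]_x (step k (fun Q => c' Q `^ p) x)%:E)%E.
  apply: eq_integral => x _; rewrite /= ger0_norm ?step_ge0//; congr EFin.
  have [[W PW Wx]|nW] := pselect (exists2 W, P k W & W x).
    by rewrite !(step_in _ PW Wx).
  rewrite !step_out ?powR0 ?gt_eqF// => W PW Wx; apply: nW; exists W => //.
rewrite integral_step => [|Q]; last exact: powR_ge0.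
congr EFin; apply: eq_fsbigr => Q /set_mem PQ.
have v0 := cells_gt0 hG PQ.
rewrite /c' powRM ?powR_ge0// -powRrM mulNr mulVf ?gt_eqF// powR_inv1 ?(ltW v0)//.
by rewrite -mulrA mulVf ?gt_eqF// mulr1.
Qed.

Lemma Lnorm_gconv_step p t (c : set T -> R) j : 1 <= p -> 0 <= t -> (forall Q, 0 <= c Q) ->
  (Lnorm m p%:E (fun x => (gconv t
     (fun k => step k (fun Q => c Q * vol m Q `^ (- p^-1))%R x) j)%:E)
    <= (gconv t (fun k => lpn p k c) j)%:E)%E.
Proof.
move=> p1 t0 c0.
pose f k := step k (fun Q => c Q * vol m Q `^ (- p^-1)).
have mf k : measurable_fun setT (f k) by exact: measurable_step.
apply: (le_trans (Lnorm_sum m j.+1 p1 (fun k => exprn_ge0 (j - k) t0) mf)).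
under eq_bigr do rewrite Lnorm_step// -EFinM.
by rewrite sumEFin.
Qed.

End Cells.

(** * From Hoelder atoms to Souza atoms *)

Section HoelderAtoms.
Context {disp : measure_display} {T : measurableType disp} {R : realType}.
Variable m : {finite_measure set T -> \bar R}.
Local Notation normc := (@Normc.normc R).
Variables (l1 l2 : R) (X : set T) (P : nat -> set (set T)).
Hypothesis hG : cells m l1 l2 X P.
Variables (d : T -> T -> R) (D C s b p : R).
Hypothesis d_gt0 : forall x y, x <> y -> 0 < d x y.
Hypothesis C_ge0 : 0 <= C.
Hypothesis d_vol : forall k Q x y, P k Q -> Q x -> Q y ->
  d x y `^ D <= C * vol m Q.
Hypotheses (b_ge0 : 0 <= b) (s_le_b : s <= b).

(** [C / l1] compares a distance inside the parent of a cell with the volume of the cell itself; the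
    summand 1 is the bound on an atom at one point of its cell. *)
Local Notation K := (1 + (C / l1) `^ b).

Let l1_gt0 : 0 < l1. Proof. by case/andP: (cells_l1 hG). Qed.
Let C_le : C <= C / l1.
Proof. by rewrite ler_pdivlMr// ler_piMr//; case/andP: (cells_l1 hG). Qed.
Let Cl1_ge0 : 0 <= C / l1. Proof. by rewrite (le_trans C_ge0). Qed.

Lemma hoelder_osc (phi : T -> R[i]) Q x y v :
  hoelder_atom m d D s b p Q phi -> Q x -> Q y -> d x y `^ D <= v ->
  normc (phi x - phi y) <= vol m Q `^ (s - p^-1 - b) * v `^ b.
Proof.
move=> [_ H _] Qx Qy dv; have [->|/eqP xy] := eqVneq x y.
  by rewrite subrr Normc.normc0 mulr_ge0 ?powR_ge0.
have d0 := d_gt0 xy.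
have := H x y Qx Qy xy; rewrite ler_pdivrMr ?powR_gt0// => /le_trans; apply.
rewrite ler_wpM2l ?powR_ge0// powRrM ge0_ler_powR// ?nnegrE ?powR_ge0//.
exact: le_trans (powR_ge0 _ _) dv.
Qed.

(* The bound in the definition of an atom is only essential, hence attained at
   some point of [Q]; the Hoelder condition carries it to every point. *)
Lemma hoelder_sup (phi : T -> R[i]) k Q x : P k Q ->
  hoelder_atom m d D s b p Q phi -> Q x ->
  normc (phi x) <= K * vol m Q `^ (s - p^-1).
Proof.
move=> PQ hphi Qx; have v0 := cells_gt0 hG PQ.
have [y Qy phiy] : exists2 y, Q y & normc (phi y) <= vol m Q `^ (s - p^-1).
  case: hphi => _ _; rewrite /Lp_norm unlock.
  have mQ0 : (0 < m Q)%E.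
    rewrite lt0e measure_ge0 andbT; apply/eqP => mQ.
    by move: v0; rewrite /vol mQ ltxx.
  have mT0 : (0 < m setT)%E.
    apply: (lt_le_trans mQ0); apply: le_measure => //; rewrite inE//.
    exact: (cells_measurable hG PQ).
  rewrite mT0 => /ess_supP[N [mN N0 HN]]; apply: contrapT => H.
  have QN : Q `<=` N.
    move=> y Qy; apply: HN => /= phiy; apply: H; exists y => //.
    by move: phiy; rewrite ger0_norm ?normc_ge0// lee_fin.
  have mQN : (m Q <= m N)%E.
    by apply: le_measure => //; rewrite inE//; exact: (cells_measurable hG PQ).
  by move: mQN; rewrite N0 leNgt mQ0.
have osc := hoelder_osc hphi Qx Qy (d_vol PQ Qx Qy).
have -> : phi x = (phi x - phi y) + phi y by rewrite subrK.
apply: (le_trans (le_normcD _ _)).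
rewrite mulrDl mul1r addrC lerD//.
apply: (le_trans osc).
rewrite powRM ?(ltW v0)// mulrCA -powRD ?(gt_eqF v0) ?implybT// subrK.
by rewrite ler_wpM2r ?powR_ge0// ge0_ler_powR// nnegrE.
Qed.

(** In [w]^ b = w [^ s * w]^ (b - s)[the volume bound is inserted into the second factor only: the
    surplus of smoothness becomes the rate, and]w [^ s] is kept for the Souza normalisation. *)
Lemma powR_scale (w v : R) i : 0 < w -> 0 < v -> w <= l2 ^+ i * v ->
  v `^ (s - b) * w `^ b <= w `^ s * (l2 `^ (b - s)) ^+ i.
Proof.
move=> w0 v0 wv; have /andP[l20 _] := cells_l2 hG.
have -> : w `^ b = w `^ s * w `^ (b - s).
  by rewrite -powRD ?(gt_eqF w0) ?implybT// addrC subrK.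
have -> : s - b = - (b - s) by rewrite opprB.
rewrite powRN mulrCA ler_wpM2l ?powR_ge0//.
rewrite mulrC ler_pdivrMr ?powR_gt0//.
rewrite -powR_mulrn ?powR_ge0// powRAC powR_mulrn ?(ltW l20)//.
rewrite -powRM ?exprn_ge0 ?(ltW l20) ?(ltW v0)//.
by rewrite ge0_ler_powR ?subr_ge0// nnegrE ?ltW// (lt_le_trans w0).
Qed.

Variables (sigma : set T -> R[i]) (a : set T -> T -> R[i]).
Hypothesis atom_a : forall k Q, P k Q -> hoelder_atom m d D s b p Q (a Q).

Local Notation L := (level_sum P sigma a).
Local Notation t := (l2 `^ (b - s)).
Local Notation cf := (fun Q => normc (sigma Q) * vol m Q `^ (- p^-1)).
Local Notation u x := (fun k => step P k cf x).

Lemma level_sum_in k Q x : P k Q -> Q x -> L k x = sigma Q * a Q x.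
Proof.
move=> PQ Qx; rewrite /level_sum (fsbig_cell hG PQ Qx)// => W PW Wx.
by have [-> //] := atom_a PW; rewrite mulr0.
Qed.

Lemma level_sum_out k x : (forall W, P k W -> ~ W x) -> L k x = 0.
Proof.
move=> H; apply: fsbig1 => W PW; have [-> //] := atom_a PW; first by rewrite mulr0.
exact: H.
Qed.

Lemma density_ge0 k x : 0 <= u x k.
Proof. by apply: step_ge0 => Q; rewrite mulr_ge0 ?powR_ge0 ?normc_ge0. Qed.

Lemma level_sum_osc k i Q W x y : P k Q -> Q x -> Q y -> P (k + i)%N W ->
  W `<=` Q -> d x y `^ D <= C / l1 * vol m W ->
  normc (L k x - L k y) <= (C / l1) `^ b * (vol m W `^ s * (t ^+ i * u x k)).
Proof.
move=> PQ Qx Qy PW WQ dxy.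
have [V [PV WV wV]] := cells_anc hG PW.
have [z Wz] := cells_ne hG PW.
have VQ : V = Q by apply: (cells_eq hG PV PQ (WV _ Wz) (WQ _ Wz)).
have v0 := cells_gt0 hG PQ; have w0 := cells_gt0 hG PW.
rewrite {V PV WV}VQ in wV.
rewrite (level_sum_in PQ Qx) (level_sum_in PQ Qy) -mulrBr Normc.normcM.
rewrite (step_in hG _ PQ Qx).
have osc := hoelder_osc (atom_a PQ) Qx Qy dxy.
apply: (le_trans (ler_wpM2l (normc_ge0 _) osc)).
rewrite powRM ?(ltW w0)//.
have -> : s - p^-1 - b = - p^-1 + (s - b) by ring.
rewrite (@powRD _ (vol m Q)) ?(gt_eqF v0) ?implybT//.
have := powR_scale w0 v0 wV.
set A1 := vol m Q `^ (- _); set A2 := vol m Q `^ _; set A3 := vol m W `^ b.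
set A4 := vol m W `^ s; set A5 := _ ^+ i; set A6 := (C / l1) `^ b.
set n := normc (sigma Q) => H.
have n0 : 0 <= n * A1 * A6 by rewrite !mulr_ge0 ?normc_ge0 ?powR_ge0.
rewrite [leLHS](_ : _ = n * A1 * A6 * (A2 * A3)); last by ring.
rewrite [leRHS](_ : _ = n * A1 * A6 * (A4 * A5)); last by ring.
exact: ler_wpM2l.
Qed.

Lemma level_sum_sup k Q x : P k Q -> Q x ->
  normc (L k x) <= K * (vol m Q `^ s * u x k).
Proof.
move=> PQ Qx; have v0 := cells_gt0 hG PQ.
rewrite (level_sum_in PQ Qx) Normc.normcM (step_in hG _ PQ Qx).
apply: (le_trans (ler_wpM2l (normc_ge0 _) (hoelder_sup PQ (atom_a PQ) Qx))).
by rewrite powRD ?(gt_eqF v0) ?implybT// le_eqVlt; apply/orP; left; apply/eqP; ring.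
Qed.

Lemma density_const k j W x y : (k <= j)%N -> P j W -> W x -> W y -> u x k = u y k.
Proof.
move=> kj; rewrite -(subnKC kj) => PW Wx Wy.
have [Q [PQ WQ _]] := cells_anc hG PW.
by rewrite !(step_in hG _ PQ)//; exact: WQ.
Qed.

(** A cell of level [j] lies in one cell of each coarser level, where the density is constant;
    estimates at the sample point thus hold on the whole cell. *)
Lemma gconv_density_const j W x y : P j W -> W x -> W y ->
  gconv t (u x) j = gconv t (u y) j.
Proof.
move=> PW Wx Wy; apply: eq_bigr => k _; congr (_ * _).
by apply: (density_const _ PW Wx Wy); rewrite -ltnS.
Qed.

Lemma partial_sum_osc j W x y : P j W -> W x -> W y ->
  normc (\sum_(k < j.+1) L k x - \sum_(k < j.+1) L k y) <=
  K * (vol m W `^ s * gconv t (u x) j).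
Proof.
move=> PW Wx Wy; rewrite -sumrB.
apply: (le_trans (normc_sum_le _ (fun k => L k x - L k y))).
rewrite /gconv !mulr_sumr; apply: ler_sum => k _.
have kj : (k <= j)%N by rewrite -ltnS.
have PW' : P (k + (j - k))%N W by rewrite subnKC.
have [Q [PQ WQ _]] := cells_anc hG PW'.
have w0 := cells_gt0 hG PW.
apply: (le_trans (level_sum_osc PQ (WQ _ Wx) (WQ _ Wy) PW' WQ _)).
  by apply: (le_trans (d_vol PW Wx Wy)); apply: ler_wpM2r => //; exact: ltW.
rewrite ler_wpM2r ?lerDr//.
by rewrite !mulr_ge0 ?powR_ge0 ?exprn_ge0 ?powR_ge0 ?density_ge0.
Qed.

Lemma increment_le j W V x y : P j.+1 W -> P j V -> W `<=` V ->
  l1 * vol m V <= vol m W -> W x -> V y ->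
  normc (\sum_(k < j.+2) L k x - \sum_(k < j.+1) L k y) <=
  K * (vol m W `^ s * gconv t (u x) j.+1).
Proof.
move=> PW PV WV wv Wx Vy; have w0 := cells_gt0 hG PW.
(* The newest level has no counterpart at [y]; it is bounded by its supremum and yields the term
   [k = j.+1] of the convolution. *)
rewrite big_ord_recr/= addrAC -sumrB.
apply: (le_trans (le_normcD _ _)).
have -> : gconv t (u x) j.+1 =
    \sum_(k < j.+1) t ^+ (j.+1 - k) * u x k + u x j.+1.
  by rewrite /gconv big_ord_recr/= subnn expr0 mul1r.
rewrite !mulrDr lerD//; last first.
  exact: level_sum_sup.
apply: (le_trans (normc_sum_le _ (fun k => L k x - L k y))).
rewrite !mulr_sumr; apply: ler_sum => k _.
have kj : (k <= j)%N by rewrite -ltnS.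
have PW' : P (k + (j.+1 - k))%N W by rewrite subnKC// leqW.
have PV' : P (k + (j - k))%N V by rewrite subnKC.
have [Q [PQ VQ _]] := cells_anc hG PV'.
have WQ := subset_trans WV VQ.
apply: (le_trans (level_sum_osc PQ (WQ _ Wx) (VQ _ Vy) PW' WQ _)).
  (* [y] lies only in the parent [V], and [vol m V <= vol m W / l1] produces the constant
     [C / l1]. *)
  apply: (le_trans (d_vol PV (WV _ Wx) Vy)).
  by rewrite -mulrA ler_wpM2l// mulrC ler_pdivlMr// mulrC.
rewrite ler_wpM2r ?lerDr//.
by rewrite !mulr_ge0 ?powR_ge0 ?exprn_ge0 ?powR_ge0 ?density_ge0.
Qed.

Local Notation B := (fun k => lpn P p k (fun Q => normc (sigma Q))).
Local Notation partial n x := (\sum_(k < n) L k x).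

(** Sample points and parents are picked by choice, and the level of [W] is read off from the set by
    [cells_level_uniq]. Level 0 has no parent, so there the sample itself is the increment. *)
Lemma increments_exist : exists (pt : set T -> T) (V : set T -> R[i]),
  [/\ forall j W, P j W -> W (pt W),
      forall W, P 0%N W -> V W = L 0%N (pt W) &
      forall j W, P j.+1 W -> exists W', [/\ P j W', W `<=` W',
        l1 * vol m W' <= vol m W &
        V W = partial j.+2 (pt W) - partial j.+1 (pt W')]].
Proof.
have [x0 _] : exists x, X x by apply: (cells_ne hG (k := 0)); rewrite (cells_root hG).
pose pt W := xget x0 W; pose lev W := xget 0%N [set k | P k W].
pose par W := xget set0
  [set V | [/\ P (lev W).-1 V, W `<=` V & l1 * vol m V <= vol m W]].
have levE j W : P j W -> lev W = j.
  by move=> PW; apply: xget_unique => // k /(cells_level_uniq hG PW).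
exists pt, (fun W => if lev W is j.+1 then
  partial j.+2 (pt W) - partial j.+1 (pt (par W)) else L 0%N (pt W)); split.
- by move=> j W /(cells_ne hG); exact: xgetPex.
- by move=> W /levE ->.
move=> j W PW; rewrite (levE _ _ PW); exists (par W).
suff [] : [set V | [/\ P (lev W).-1 V, W `<=` V & l1 * vol m V <= vol m W]] (par W).
  by rewrite (levE _ _ PW).
apply: xgetPex; have [W' [PW' WW' lW _]] := cells_parent hG PW.
by exists W'; rewrite /= (levE _ _ PW).
Qed.

(** * The increments as a Souza representation *)

Section Increments.
Variables (pt : set T -> T) (V : set T -> R[i]).
Hypothesis ptP : forall j W, P j W -> W (pt W).
Hypothesis V0 : forall W, P 0%N W -> V W = L 0%N (pt W).
Hypothesis VS : forall j W, P j.+1 W -> exists W', [/\ P j W', W `<=` W',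
  l1 * vol m W' <= vol m W &
  V W = partial j.+2 (pt W) - partial j.+1 (pt W')].

Local Notation nu := (fun W => vol m W `^ (s - p^-1)).

(* [V W] is the value on [W] of the increment of the sampled partial sums. *)
Definition incr_coef (W : set T) : R[i] := V W / (nu W)%:C%C.
(** The Souza atom of maximal height on [W], so that the coefficient is the value divided by that
    height. *)
Definition incr_atom (W : set T) (x : T) : R[i] := (nu W * \1_W x)%:C%C.

Local Notation N := (level_sum P incr_coef incr_atom).

Lemma incr_atom_souza W : souza m s p W (incr_atom W).
Proof.
split.
- by exists (nu W)%:C%C => x Wx; rewrite /incr_atom indicE mem_set// mulr1.
- by move=> x Wx; rewrite /incr_atom indicE memNset// mulr0.
- move=> x; rewrite /incr_atom normc_real normrM !ger0_norm ?powR_ge0//.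
  by rewrite ler_piMr ?powR_ge0// indicE lern1 leq_b1.
Qed.

Lemma incr_in j W x : P j W -> W x -> N j x = V W.
Proof.
move=> PW Wx; rewrite /level_sum (fsbig_cell hG PW Wx).
  rewrite /incr_coef /incr_atom indicE mem_set// mulr1 divfK//.
  have := powR_gt0 (s - p^-1) (cells_gt0 hG PW).
  by apply: contraTneq => /eqP; rewrite eq_complex/= => /andP[/eqP-> _]; rewrite ltxx.
by move=> Q PQ Qx; rewrite /incr_atom indicE memNset// !mulr0.
Qed.

Lemma incr_out j x : (forall W, P j W -> ~ W x) -> N j x = 0.
Proof.
move=> H; apply: fsbig1 => W /H Wx.
by rewrite /incr_atom indicE memNset// !mulr0.
Qed.

Lemma incr_proj (pr : R[i] -> R) j : pr 0 = 0 ->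
  (fun x => pr (N j x)) = step P j (pr \o V).
Proof.
move=> pr0; apply/funext => x.
have [[W PW Wx]|nW] := pselect (exists2 W, P j W & W x).
  by rewrite (incr_in PW Wx) (step_in hG _ PW Wx).
have H W : P j W -> ~ W x by move=> PW Wx; apply: nW; exists W.
by rewrite incr_out// step_out.
Qed.

Lemma incr_ae_measurable j : ae_measurable m (N j).
Proof.
by exists (N j); split; [rewrite incr_proj..|exact: aeW] => //; exact: measurable_step hG _ _.
Qed.

Lemma incr_telescope j W x : P j W -> W x ->
  \sum_(i < j.+1) N i x = partial j.+1 (pt W).
Proof.
elim: j W => [|j IH] W PW Wx.
  by rewrite !big_ord1 (incr_in PW Wx) V0.
rewrite big_ord_recr/= (incr_in PW Wx).
have [W' [PW' WW' _ ->]] := VS PW.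
by rewrite (IH _ PW' (WW' _ Wx)) addrC subrK.
Qed.

Lemma incr_norm_le j W x : P j W -> W x ->
  normc (V W) <= K * (vol m W `^ s * gconv t (u x) j).
Proof.
move=> PW Wx; rewrite (gconv_density_const PW Wx (ptP PW)).
case: j PW => [|j] PW.
  by rewrite (V0 PW) gconv0; exact: level_sum_sup PW (ptP PW).
have [W' [PW' WW' lW ->]] := VS PW.
exact: increment_le PW PW' WW' lW (ptP PW) (ptP PW').
Qed.

Lemma gconv_density_ge0 x j : 0 <= gconv t (u x) j.
Proof. by apply: gconv_ge0 => [|k]; [exact: powR_ge0|exact: density_ge0]. Qed.

Hypotheses (p_ge1 : 1 <= p) (s_ge0 : 0 <= s).

Local Notation kappa := (K * vol m X `^ s).
Local Notation rho := (l2 `^ s).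

Lemma vol_powR_le j W : P j W -> vol m W `^ s <= vol m X `^ s * rho ^+ j.
Proof.
move=> PW; have [_ H] := cells_sub hG PW.
have /andP[l20 _] := cells_l2 hG.
have w0 := cells_gt0 hG PW.
have X0 : 0 < vol m X by apply: (cells_gt0 hG (k := 0)); rewrite (cells_root hG).
apply: le_trans (ge0_ler_powR s_ge0 _ _ H) _; rewrite ?nnegrE ?(ltW w0)//.
  by rewrite mulr_ge0 ?exprn_ge0 ?ltW.
rewrite powRM ?exprn_ge0 ?(ltW l20) ?(ltW X0)// mulrC ler_wpM2l ?powR_ge0//.
by rewrite -(powR_mulrn j (powR_ge0 l2 s)) -(powR_mulrn j (ltW l20)) powRAC.
Qed.

Lemma ae_incr_norm_le : {ae m, forall x j,
  normc (N j x) <= kappa * rho ^+ j * gconv t (u x) j /\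
  normc (partial j.+1 x - \sum_(i < j.+1) N i x) <=
    kappa * rho ^+ j * gconv t (u x) j}.
Proof.
have := ae_cells hG; apply: filterS => x Hx j.
have c0 : 0 <= kappa * rho ^+ j * gconv t (u x) j.
  by rewrite !mulr_ge0 ?exprn_ge0 ?powR_ge0 ?gconv_density_ge0// addr_ge0 ?powR_ge0.
have [Xx|nX] := pselect (X x); last first.
  have H k W : P k W -> ~ W x by move=> PW Wx; apply: nX; exact: (cells_sub hG PW).1.
  rewrite incr_out ?Normc.normc0; last exact: H.
  rewrite !big1 ?subrr ?Normc.normc0// => k _; first exact/incr_out/H.
  exact/level_sum_out/H.
have [W PW Wx] := Hx Xx j.
have le_ : K * (vol m W `^ s * gconv t (u x) j) <= kappa * rho ^+ j * gconv t (u x) j.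
  rewrite mulrA ler_wpM2r ?gconv_density_ge0// -[leRHS]mulrA ler_wpM2l ?vol_powR_le//.
  by rewrite addr_ge0 ?powR_ge0.
split; apply: le_trans le_.
  by rewrite (incr_in PW Wx); exact: incr_norm_le.
by rewrite (incr_telescope PW Wx); exact: partial_sum_osc PW Wx (ptP PW).
Qed.

Lemma Lp_norm_gconv_le (f : T -> R[i]) c j : 0 <= c ->
  {ae m, forall x, normc (f x) <= c * gconv t (u x) j} ->
  (Lp_norm m p%:E f <= (c * gconv t B j)%:E)%E.
Proof.
move=> c0 fle; have p0 : 0 <= p by rewrite (le_trans _ p_ge1).
apply: (le_trans (Lp_norm_le p0 fle)).
have mg : measurable_fun setT (fun x => gconv t (u x) j).
  apply: measurable_sum => k; apply: measurable_funM => //.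
  exact: measurable_step hG _ _.
rewrite (LnormZ_EFin _ p_ge1 c0 mg) EFinM lee_wpmul2l ?lee_fin//.
by apply: (Lnorm_gconv_step hG _ p_ge1 _ (fun Q => normc_ge0 _)); exact: powR_ge0.
Qed.

(** On [W] the step function of [Lnorm_step] equals [normc (V W) * vol m W]^ (-
    s)[, so the factor]vol m W [^ s] of [incr_norm_le] cancels and the norm of the convolution of
    densities remains. *)
Lemma lpn_incr_coef_le j :
  lpn P p j (fun W => normc (incr_coef W)) <= K * gconv t B j.
Proof.
have K0 : 0 <= K by rewrite addr_ge0 ?powR_ge0.
rewrite -lee_fin -(Lnorm_step hG _ p_ge1 (fun Q => normc_ge0 _)).
set st := step _ _ _.
have -> : Lnorm m p%:E (EFin \o st) = Lp_norm m p%:E (fun x => (st x)%:C%C).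
  apply: eq_Lnorm => x; rewrite normc_real ger0_norm// step_ge0// => Q.
  by rewrite mulr_ge0 ?powR_ge0 ?normc_ge0.
apply: Lp_norm_gconv_le => //.
have := ae_cells hG; apply: filterS => x Hx.
have [[W PW Wx]|nW] := pselect (exists2 W, P j W & W x); last first.
  rewrite /st step_out ?normc_real ?normr0 ?mulr_ge0 ?gconv_density_ge0//.
  by move=> W PW Wx; apply: nW; exists W.
have v0 := cells_gt0 hG PW.
rewrite normc_real /st (step_in hG _ PW Wx) ger0_norm; last first.
  by rewrite mulr_ge0 ?powR_ge0 ?normc_ge0.
rewrite /incr_coef Normc.normcM Normc.normcV normc_real ger0_norm ?powR_ge0//.
rewrite -powRN -mulrA -powRD ?(gt_eqF v0) ?implybT//.
rewrite (_ : - (s - p^-1) - p^-1 = - s); last by ring.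
rewrite powRN ler_pdivrMr ?powR_gt0//.
by rewrite -mulrA [X in K * X]mulrC incr_norm_le.
Qed.

End Increments.

Lemma hoelder_to_souza (g : T -> R[i]) (M : R) : 1 <= p -> 0 < s -> ae_measurable m g ->
  (forall k, ae_measurable m (L k)) ->
  (fun n => Lp_norm m p%:E (fun x => g x - partial n x)) @ \oo --> 0%E ->
  (forall j, gconv t B j <= M) ->
  exists S A, atomic_rep m P (souza m s p) p g S A /\
    forall j, lpn P p j (fun W => normc (S W)) <= K * gconv t B j.
Proof.
move=> p1 s0 mg mL gL gM; have /andP[l20 l21] := cells_l2 hG.
have [pt [V [ptP V0 VS]]] := increments_exist.
exists (incr_coef V), incr_atom; split; last first.
  by move=> j; apply: (lpn_incr_coef_le ptP V0 VS).
set N := level_sum P (incr_coef V) incr_atom.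
pose rho := l2 `^ s; pose kappa := K * vol m X `^ s.
have rho0 : 0 <= rho by exact: powR_ge0.
have rho1 : rho < 1.
  have -> : 1 = 1 `^ s :> R by rewrite powR1.
  by apply: gt0_ltr_powR; rewrite ?nnegrE// ltW.
have K0 : 0 <= K by rewrite addr_ge0 ?powR_ge0.
have kappa0 : 0 <= kappa by rewrite mulr_ge0 ?powR_ge0.
have M0 : 0 <= M.
  apply: le_trans (gM 0%N); apply: gconv_ge0; first exact: powR_ge0.
  by move=> k; exact: lpn_ge0.
have aeN := ae_incr_norm_le ptP V0 VS (ltW s0).
have le_norm (f : T -> R[i]) j : {ae m, forall x,
    normc (f x) <= kappa * rho ^+ j * gconv t (u x) j} ->
    (Lp_norm m p%:E f <= (kappa * rho ^+ j * M)%:E)%E.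
  move=> H; have c0 : 0 <= kappa * rho ^+ j by rewrite mulr_ge0 ?exprn_ge0.
  apply: (le_trans (Lp_norm_gconv_le p1 c0 H)).
  by rewrite lee_fin ler_wpM2l.
have NormN j : (Lp_norm m p%:E (N j) <= (kappa * rho ^+ j * M)%:E)%E.
  by apply: le_norm; apply: filterS aeN => x /(_ j)[].
have Nmeas j : ae_measurable m (N j) by exact: incr_ae_measurable.
split.
- by move=> k Q _; exact: incr_atom_souza.
- by move=> k; split; [exact: Nmeas|rewrite (le_lt_trans (NormN k)) ?ltry].
- apply: (@le_lt_trans _ _ (kappa * M * (1 - rho)^-1)%:E); last exact: ltry.
  apply: lime_le; first by apply: is_cvg_nneseries => n _ _; exact: Lnorm_ge0.
  apply: nearW => n.
  apply: (@le_trans _ _ (\sum_(0 <= k < n) (kappa * rho ^+ k * M)%:E)%E).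
    by apply: lee_sum.
  rewrite sumEFin lee_fin; under eq_bigr do rewrite mulrAC.
  by apply: sum_geometric_le; [exact: mulr_ge0|rewrite rho0].
have Gmeas j : ae_measurable m (fun x => partial j.+1 x).
  exact: ae_measurable_sum.
have Nsmeas j : ae_measurable m (fun x => \sum_(i < j.+1) N i x).
  exact: ae_measurable_sum.
(* The new remainder is the remainder of the given expansion plus the error of sampling its partial
   sums; both tend to 0. *)
have bound j : (Lp_norm m p%:E (fun x => g x - \sum_(k < j.+1) N k x)%R <=
    Lp_norm m p%:E (fun x => g x - partial j.+1 x)%R +
    (kappa * rho ^+ j * M)%:E)%E.
  have -> : (fun x => g x - \sum_(k < j.+1) N k x) =
      (fun x => (g x - partial j.+1 x) +
                (partial j.+1 x - \sum_(k < j.+1) N k x)).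
    by apply/funext => x; rewrite addrA subrK.
  have H1 : ae_measurable m (fun x => g x - partial j.+1 x).
    by apply: ae_measurableD => //; exact: ae_measurableN.
  have H2 : ae_measurable m (fun x => partial j.+1 x - \sum_(k < j.+1) N k x).
    by apply: ae_measurableD => //; exact: ae_measurableN.
  apply: (le_trans (Lp_normD p1 H1 H2)).
  rewrite leeD2l//; apply: le_norm; by apply: filterS aeN => x /(_ j)[].
rewrite -cvg_shiftS /=.
pose h j := (Lp_norm m p%:E (fun x => g x - partial j.+1 x)%R +
  (kappa * rho ^+ j * M)%:E)%E.
suff h0 : h @ \oo --> 0%E.
  apply: squeeze_cvge (cvg_cst 0%E) h0.
  by apply: nearW => j; rewrite bound andbT; exact: Lnorm_ge0.
rewrite -[X in _ --> X]adde0; apply: cvgeD => //.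
  by move: gL; rewrite -cvg_shiftS.
apply/cvg_EFin; first exact: nearW.
rewrite -(mul0r M) -(mulr0 kappa); apply: cvgM; last exact: cvg_cst.
apply: cvgM; first exact: cvg_cst.
by apply: cvg_expr; rewrite ger0_norm.
Qed.

End HoelderAtoms.

(** * Good grids and single atoms *)

Section GoodGridCells.
Context {disp : measure_display} {T : measurableType disp} {R : realType}.
Variable m : {finite_measure set T -> \bar R}.
Variables (l1 l2 : R) (P : nat -> set (set T)).

Lemma cells_good_grid : good_grid m l1 l2 P -> cells m l1 l2 setT P.
Proof.
case=> l10 l12 l21 fin meas pos root cover disj nested ratio _.
have vol0 k Q : P k Q -> 0 < vol m Q.
  by move=> PQ; rewrite fine_gt0// (pos _ _ PQ)/= ltey_eq fin_num_measure//; exact: meas PQ.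
split=> //.
- by rewrite l10 ltW// (lt_trans l12).
- by rewrite l21 andbT (lt_trans l10).
- by move=> k; rewrite setTD.
- by move=> k Q W x PQ PW Qx Wx; apply: (disj k) => //; exists x.
- move=> k Q PQ; have [W PW QW] := nested _ _ PQ; exists W.
  have := ratio _ _ _ PQ PW QW.
  by rewrite ler_pdivlMr ?ler_pdivrMr ?(vol0 _ _ PW)// => /andP[].
Qed.

Lemma cells_subgrid k0 Q : cells m l1 l2 setT P -> P k0 Q ->
  cells m l1 l2 Q (subgrid P k0 Q).
Proof.
(* A cell of level [k0 + i] that meets [Q] has an ancestor at level [k0], which is [Q] by
   disjointness. *)
move=> hG PQ; have up i W x : P (k0 + i)%N W -> W x -> Q x -> W `<=` Q.
  move=> PW Wx Qx; have [V [PV WV _]] := cells_anc hG PW.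
  by rewrite (cells_eq hG PQ PV Qx (WV _ Wx)).
have [x0 Qx0] := cells_ne hG PQ.
split.
- exact: cells_l1 hG.
- exact: cells_l2 hG.
- by move=> k; apply: sub_finite_set (cells_finite hG (k0 + k)) => W [].
- by move=> k W [PW _]; exact: (cells_measurable hG PW).
- by move=> k W [PW _]; exact: (cells_gt0 hG PW).
- apply/seteqP; split => W.
    move=> [/=]; rewrite addn0 => PW WQ; have [x Wx] := cells_ne hG PW.
    exact: (cells_eq hG PW PQ Wx (WQ _ Wx)).
  by move=> /= ->; rewrite /subgrid/= addn0; split.
- move=> k; apply: (@subset_measure0 _ _ _ m _ (setT `\` \bigcup_(W in P (k0 + k)%N) W)).
  + apply: measurableD; first exact: (cells_measurable hG PQ).
    apply: fin_bigcup_measurable.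
      by apply: sub_finite_set (cells_finite hG (k0 + k)) => W [].
    by move=> W [PW _]; exact: (cells_measurable hG PW).
  + apply: measurableD => //; apply: fin_bigcup_measurable.
      exact: (cells_finite hG).
    by move=> W PW; exact: (cells_measurable hG PW).
  + move=> x [Qx nx]; split => // -[W PW Wx]; apply: nx; exists W => //.
    by split => //; exact: up PW Wx Qx.
  + exact: (cells_cover hG).
- by move=> k V W x [PV _] [PW _]; exact: (cells_eq hG PV PW).
- move=> k W [+ WQ]; rewrite addnS => PW.
  have [V [PV WV lo hi]] := cells_parent hG PW; exists V; split => //; split => //.
  have [x Wx] := cells_ne hG PW; exact: up PV (WV _ Wx) (WQ _ Wx).
Qed.

(** [sup] is sure to dominate only the elements of a set bounded above, and [d_bounded] provides
    this for the distances within [Q]. *)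
Lemma powR_dist_le_vol (d : T -> T -> R) (C D : R) k Q x y :
  (forall x y, 0 <= d x y) -> d_bounded d Q -> 0 <= D ->
  diam d Q `^ D <= C `^ D * vol m Q -> P k Q -> Q x -> Q y ->
  d x y `^ D <= C `^ D * vol m Q.
Proof.
move=> d0 [M dM] D0 H PQ Qx Qy; apply: le_trans H.
have dle : d x y <= diam d Q.
  apply: ub_le_sup; last by exists x, y.
  by exists M => _ [u [v [Qu Qv ->]]]; exact: dM.
by apply: ge0_ler_powR => //; rewrite nnegrE// (le_trans (d0 x y)).
Qed.

End GoodGridCells.

(** * Single Hoelder atoms as functions and as representations *)

Section Atoms.
Context {disp : measure_display} {T : measurableType disp} {R : realType}.
Variable m : {finite_measure set T -> \bar R}.
Local Notation normc := (@Normc.normc R).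
Variables (d : T -> T -> R) (D : R).

Lemma Linfty_norm_le (f : T -> R[i]) (M : R) : 0 <= M ->
  (forall x, normc (f x) <= M) -> (Lp_norm m +oo f <= M%:E)%E.
Proof.
move=> M0 fM; rewrite /Lp_norm unlock; case: ifPn => // _.
by apply/ess_supP/aeW => x /=; rewrite ger0_norm ?normc_ge0// lee_fin.
Qed.

Lemma souza_hoelder s b p Q : souza m s p Q `<=` hoelder_atom m d D s b p Q.
Proof.
move=> f [[c fc] f0 fM]; split => //.
- move=> x y Qx Qy _; rewrite !fc// subrr Normc.normc0 mul0r; exact: powR_ge0.
- by apply: Linfty_norm_le => //; exact: powR_ge0.
Qed.

Lemma hoelder0 s b p Q : hoelder_atom m d D s b p Q (fun => 0).
Proof.
apply: souza_hoelder; split => //; first by exists 0.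
by move=> x; rewrite Normc.normc0 powR_ge0.
Qed.

Lemma Linfty_normZ (f : T -> R[i]) (c : R) : 0 <= c ->
  (Lp_norm m +oo (fun x => c%:C%C * f x)%R <= c%:E * Lp_norm m +oo f)%E.
Proof.
move=> c0; rewrite /Lp_norm unlock; case: ifPn => [m0|_]; last by rewrite mule0.
rewrite -ess_supZl//; apply: le_ess_sup; apply: aeW => x /=.
by rewrite Normc.normcM normc_real !ger0_norm ?mulr_ge0 ?normc_ge0.
Qed.

(** [s] enters both bounds as an exponent of the volume, so one power of [vol m Q] shifts it. This
    moves an atom to the smoothness of the Besov space on its cell. *)
Lemma hoelder_rescale s s' b p Q (phi : T -> R[i]) : 0 < vol m Q ->
  hoelder_atom m d D s b p Q phi ->
  hoelder_atom m d D s' b p Q (fun x => (vol m Q `^ (s' - s))%:C%C * phi x).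
Proof.
move=> v0 [phi0 phiH phiM].
have E u : vol m Q `^ (s' + u) = vol m Q `^ (s' - s) * vol m Q `^ (s + u).
  by rewrite -powRD ?(gt_eqF v0) ?implybT// addrA subrK.
split.
- by move=> x Qx; rewrite phi0// mulr0.
- move=> x y Qx Qy xy; rewrite -mulrBr Normc.normcM normc_real.
  rewrite ger0_norm ?powR_ge0// -!addrA (E (- p^-1 - b)) -mulrA ler_wpM2l ?powR_ge0//.
  by rewrite !addrA; exact: phiH.
- rewrite (E (- p^-1)) EFinM; apply: (le_trans (Linfty_normZ _ (powR_ge0 _ _))).
  by rewrite lee_wpmul2l ?lee_fin ?powR_ge0.
Qed.

Variables (l1 l2 : R) (X : set T) (P : nat -> set (set T)).
Hypothesis hG : cells m l1 l2 X P.
Variable (C : R).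
Hypothesis d_gt0 : forall x y, x <> y -> 0 < d x y.
Hypothesis C_ge0 : 0 <= C.
Hypothesis d_vol : forall k Q x y, P k Q -> Q x -> Q y ->
  d x y `^ D <= C * vol m Q.

(** Measurability comes from approximation: samples at one point per cell form step functions that
    converge almost everywhere by the Hoelder bound. Boundedness and finite measure give the
    norm. *)
Lemma hoelder_in_Lp s b p (phi : T -> R[i]) : 1 <= p -> 0 < b ->
  hoelder_atom m d D s b p X phi -> in_Lp m p%:E phi.
Proof.
move=> p1 b0 hphi; have PX : P 0%N X by rewrite (cells_root hG).
have p0 : 0 < p by rewrite (lt_le_trans _ p1).
have [phi0 _ _] := hphi; have /andP[l20 l21] := cells_l2 hG.
have X0 := cells_gt0 hG PX.
split; last first.
  set M := (1 + (C / l1) `^ b) * vol m X `^ (s - p^-1).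
  have M0 : 0 <= M by rewrite mulr_ge0 ?powR_ge0// addr_ge0 ?powR_ge0.
  have phiM x : normc (phi x) <= M.
    have [Xx|nX] := pselect (X x); last by rewrite phi0// Normc.normc0.
    exact: (hoelder_sup hG d_gt0 C_ge0 d_vol (ltW b0) PX hphi).
  apply: (le_lt_trans (Lp_norm_le (ltW p0) (aeW m phiM))).
  rewrite unlock poweR_lty//= integral_cst// lte_mul_pinfty ?lee_fin ?powR_ge0//.
  by rewrite ltey_eq fin_num_measure.
have [x0 Xx0] := cells_ne hG PX.
pose pt W := xget x0 W.
have ptP j W : P j W -> W (pt W) by move=> /(cells_ne hG); exact: xgetPex.
pose F j := level_sum P (fun W => phi (pt W)) (fun W x => (\1_W x)%:C%C) j.
have F_in j W x : P j W -> W x -> F j x = phi (pt W).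
  move=> PW Wx; rewrite /F /level_sum (fsbig_cell hG PW Wx).
    by rewrite indicE mem_set// mulr1.
  by move=> Q PQ Qx; rewrite indicE memNset// mulr0.
have F_out j x : (forall W, P j W -> ~ W x) -> F j x = 0.
  by move=> H; apply: fsbig1 => W /H Wx; rewrite indicE memNset// mulr0.
have F_proj (pr : R[i] -> R) j : pr 0 = 0 ->
    (fun x => pr (F j x)) = step P j (fun W => pr (phi (pt W))).
  move=> pr0; apply/funext => x.
  have [[W PW Wx]|nW] := pselect (exists2 W, P j W & W x).
    by rewrite (F_in _ _ _ PW Wx) (step_in hG _ PW Wx).
  have H W : P j W -> ~ W x by move=> PW Wx; apply: nW; exists W.
  by rewrite F_out// step_out.
apply: (ae_measurable_lim (F := F)).
- by move=> n; rewrite F_proj//; exact: measurable_step hG _ _.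
- by move=> n; rewrite F_proj//; exact: measurable_step hG _ _.
have := ae_cells hG; apply: filterS => x Hx.
have [Xx|nX] := pselect (X x); last first.
  rewrite (_ : (fun _ => _) = cst 0); first exact: cvg_cst.
  apply/funext => n; rewrite phi0// F_out ?subr0 ?Normc.normc0// => W PW Wx.
  by apply: nX; exact: (cells_sub hG PW).1.
pose c := vol m X `^ (s - p^-1 - b) * (C * vol m X) `^ b.
have c0 : 0 <= c by rewrite mulr_ge0 ?powR_ge0.
have bound n : normc (F n x - phi x) <= c * (l2 `^ b) ^+ n.
  have [W PW Wx] := Hx Xx n; rewrite (F_in _ _ _ PW Wx).
  have [WX vW] := cells_sub hG PW.
  have dle := le_trans (d_vol PW (ptP _ _ PW) Wx) (ler_wpM2l C_ge0 vW).
  apply: (le_trans (hoelder_osc d_gt0 (ltW b0) hphi (WX _ (ptP _ _ PW)) (WX _ Wx) dle)).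
  rewrite /c -mulrA ler_wpM2l ?powR_ge0//.
  rewrite mulrCA mulrC (@powRM _ (C * _)) ?exprn_ge0 ?(ltW l20) ?mulr_ge0 ?(ltW X0)//.
  by rewrite -(powR_mulrn n (powR_ge0 l2 b)) -(powR_mulrn n (ltW l20)) powRAC.
have rho1 : l2 `^ b < 1.
  have -> : 1 = 1 `^ b :> R by rewrite powR1.
  by apply: gt0_ltr_powR; rewrite ?nnegrE// ltW.
apply: (@squeeze_cvgr _ _ _ _ (cst 0) (fun n => c * (l2 `^ b) ^+ n)).
- by apply: nearW => n; rewrite normc_ge0 bound.
- exact: cvg_cst.
rewrite -(mulr0 c); apply: cvgM; first exact: cvg_cst.
by apply: cvg_expr; rewrite ger0_norm ?powR_ge0.
Qed.

(** One atom viewed as an atomic representation: the coefficient sits on the root cell, and all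
    other sets carry the zero function, which is again an atom. *)
Definition root_coef (c : R) (Q : set T) : R[i] :=
  if Q == X then c%:C%C else 0.
Definition root_atom (phi : T -> R[i]) (Q : set T) : T -> R[i] :=
  if Q == X then phi else (fun => 0).

Lemma root_atomP s b p phi Q : hoelder_atom m d D s b p X phi ->
  hoelder_atom m d D s b p Q (root_atom phi Q).
Proof.
by rewrite /root_atom => hphi; case: eqP => [->|_] //; exact: hoelder0.
Qed.

Lemma level_sum_root c phi k :
  level_sum P (root_coef c) (root_atom phi) k =
  if k is 0%N then (fun x => c%:C%C * phi x) else (fun => 0).
Proof.
apply/funext => x; rewrite /level_sum; case: k => [|k].
  by rewrite (cells_root hG) fsbig_set1 /root_coef /root_atom eqxx.
apply: fsbig1 => Q PQ; rewrite /root_coef; case: eqP => [QX|_]; last by rewrite mul0r.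
move: PQ; rewrite QX => PX; have P0 : P 0%N X by rewrite (cells_root hG).
by have := cells_level_uniq hG PX P0.
Qed.

Lemma lpn_root p c k : 0 < p -> 0 <= c ->
  lpn P p k (fun Q => normc (root_coef c Q)) = if k is 0%N then c else 0.
Proof.
move=> p0 c0; rewrite /lpn; case: k => [|k].
  rewrite (cells_root hG) fsbig_set1 /root_coef eqxx.
  by rewrite normc_real ger0_norm// -powRrM mulfV ?gt_eqF// powRr1.
rewrite fsbig1 ?powR0 ?gt_eqF ?invr_gt0// => Q PQ.
rewrite /root_coef; case: eqP => [QX|_]; last first.
  by rewrite Normc.normc0 powR0// gt_eqF.
move: PQ; rewrite QX => PX; have P0 : P 0%N X by rewrite (cells_root hG).
by have := cells_level_uniq hG PX P0.
Qed.

Lemma hoelder_atom_to_souza s b p phi c : 1 <= p -> 0 < s -> s <= b -> 0 <= c ->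
  hoelder_atom m d D s b p X phi ->
  exists S A, atomic_rep m P (souza m s p) p (fun x => c%:C%C * phi x) S A /\
    forall j, lpn P p j (fun W => normc (S W)) <=
      (1 + (C / l1) `^ b) *
      gconv (l2 `^ (b - s)) (fun k => if k is 0%N then c else 0) j.
Proof.
move=> p1 s0 sb c0 hphi; have p0 : 0 < p by rewrite (lt_le_trans _ p1).
have b0 : 0 < b by rewrite (lt_le_trans s0).
have /andP[l20 l21] := cells_l2 hG.
have [mphi _] := in_LpZ p1 c0 (hoelder_in_Lp p1 b0 hphi).
have BE : (fun k => lpn P p k (fun Q => normc (root_coef c Q))) =
    (fun k => if k is 0%N then c else 0).
  by apply/funext => k; rewrite lpn_root.
rewrite -BE.
have ha k Q : P k Q -> hoelder_atom m d D s b p Q (root_atom phi Q).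
  by move=> _; exact: root_atomP.
apply: (@hoelder_to_souza _ _ _ _ _ _ _ _ hG _ _ _ _ _ _ d_gt0 C_ge0 d_vol
  (ltW b0) sb (root_coef c) _ ha _ c) => //.
- move=> k; rewrite level_sum_root; case: k => [//|k].
  by exists (fun => 0); split => //; exact: aeW.
- rewrite -cvg_shiftS/=.
  rewrite (_ : (fun _ => _) = cst 0%E); first exact: cvg_cst.
  apply/funext => n; rewrite -[RHS](Lnorm0 m (p := p%:E)); last by rewrite eqe gt_eqF.
  apply: eq_Lnorm => x; rewrite big_ord_recl level_sum_root big1 => [|k _].
    by rewrite addr0 subrr Normc.normc0.
  by rewrite level_sum_root.
move=> j; rewrite BE; elim: j => [|j IH]; first by rewrite gconv0.
rewrite gconvS addr0 (le_trans _ IH)// ler_piMl//.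
  by apply: gconv_ge0 => [|[]//]; exact: powR_ge0.
have -> : 1 = 1 `^ (b - s) :> R by rewrite powR1.
by apply: ge0_ler_powR; rewrite ?nnegrE ?subr_ge0// ltW.
Qed.

End Atoms.

(** * Besov atoms and Besov spaces *)

Section BesovSpaces.
Context {disp : measure_display} {T : measurableType disp} {R : realType}.
Variable m : {finite_measure set T -> \bar R}.
Local Notation normc := (@Normc.normc R).
Variables (d : T -> T -> R) (D C l1 l2 : R) (P : nat -> set (set T)).
Hypothesis hG : cells m l1 l2 setT P.
Hypothesis d_gt0 : forall x y, x <> y -> 0 < d x y.
Hypothesis C_ge0 : 0 <= C.
Hypothesis d_vol : forall k Q x y, P k Q -> Q x -> Q y ->
  d x y `^ D <= C * vol m Q.
Variable p : R.
Hypothesis p_ge1 : 1 <= p.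

Let l2_gt0 : 0 < l2. Proof. by case/andP: (cells_l2 hG). Qed.
Let l2_lt1 : l2 < 1. Proof. by case/andP: (cells_l2 hG). Qed.

Lemma powR_l2_lt1 r : 0 < r -> 0 <= l2 `^ r < 1.
Proof.
move=> r0; rewrite powR_ge0; have -> : 1 = 1 `^ r :> R by rewrite powR1.
by apply: gt0_ltr_powR; rewrite ?nnegrE// ltW.
Qed.

(* The rescaled coefficients of a single atom decay like powers of
   [l2 `^ (bt - b)]; [kappa] bounds the l^q norm of such a sequence. *)
Lemma hoelder_sub_besov_atom s b bt q kappa : 0 < s -> s < b -> b <= bt ->
  (1 <= q)%E -> 0 < kappa ->
  (forall (S : nat -> R) c, 0 <= c -> (forall k, 0 <= S k) ->
    (forall k, S k <= (1 + (C / l1) `^ bt) *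
      gconv (l2 `^ (bt - b)) (fun k => if k is 0%N then c else 0) k) ->
    (Lnorm counting q (fun k => (S k)%:E) <= (kappa * c)%:E)%E) ->
  exists2 c, 0 < c & forall k Q, P k Q ->
    scale_set c (hoelder_atom m d D s bt p Q) `<=` besov_atom m P l2 s b p q k Q.
Proof.
move=> s0 sb bbt q1 kappa0 Hkappa; have b0 : 0 < b by rewrite (lt_trans s0).
have [r r0 rE] := besov_const_gt0 (cells_l2 hG) b0 q1.
(* [r] absorbs the normalising constant in the definition of Besov atoms, and [kappa] the cost of
   the representation. *)
exists (kappa * r)^-1 => [|k Q PQ _ [phi hphi <-]]; first by rewrite invr_gt0 mulr_gt0.
have v0 := cells_gt0 hG PQ.
have hQ := cells_subgrid hG PQ.
have hpsi := hoelder_rescale b v0 hphi.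
set psi := (fun x => _) in hpsi.
set c := (kappa * r)^-1 * vol m Q `^ (s - b).
have c0 : 0 <= c by rewrite mulr_ge0 ?powR_ge0// invr_ge0 ltW// mulr_gt0.
have dQ i W x y : subgrid P k Q i W -> W x -> W y -> d x y `^ D <= C * vol m W.
  by move=> [PW _]; exact: (d_vol PW).
(* [phi] is traded for the rescaled atom [psi] of smoothness [b]; the power of the volume left in
   [c] is the one in the norm bound of a Besov atom. *)
have -> : (fun x => ((kappa * r)^-1)%:C%C * phi x) = (fun x => c%:C%C * psi x).
  apply/funext => x; rewrite /psi mulrA -rmorphM/= /c -mulrA -powRD; last first.
    by rewrite (gt_eqF v0) implybT.
  by rewrite (_ : s - b + (b - s) = 0) ?powRr0 ?mulr1//; ring.
have [S [A [rep le_]]] := hoelder_atom_to_souza hQ d_gt0 C_ge0 dQ p_ge1 b0 bbt c0 hpsi.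
have costE : (cost (subgrid P k Q) p q S <= ((vol m Q `^ (s - b)) / r)%:E)%E.
  have -> : vol m Q `^ (s - b) / r = kappa * c.
    by rewrite /c; field; rewrite !gt_eqF.
  by apply: (Hkappa _ _ c0 _ le_) => j; exact: lpn_ge0.
have costy : (cost (subgrid P k Q) p q S < +oo)%E.
  by rewrite (le_lt_trans costE)// ltry.
split.
  split; last by exists S, A.
    apply: in_LpZ => //.
    exact: (hoelder_in_Lp hQ d_gt0 C_ge0 dQ p_ge1 (lt_le_trans b0 bbt) hpsi).
  by move=> x Qx; have [-> //] := hpsi; rewrite mulr0.
rewrite rE inver gt_eqF// -EFinM; apply: le_trans costE.
by apply: ereal_inf_lbound; exists S, A.
Qed.

(** Combines [hoelder_to_souza] with Young's inequality, where [s < b] gives [t < 1]. The constant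
    is uniform in [g], as equivalence of norms demands. *)
Lemma hoelder_souza_cost s b q : 0 < s -> s < b -> (1 <= q)%E ->
  exists2 kappa, 0 < kappa & forall g sigma a, ae_measurable m g ->
    atomic_rep m P (hoelder_atom m d D s b p) p g sigma a ->
    (cost P p q sigma < +oo)%E ->
    exists S A, atomic_rep m P (souza m s p) p g S A /\
      (cost P p q S <= kappa%:E * cost P p q sigma)%E.
Proof.
move=> s0 sb q1; set t := l2 `^ (b - s).
have t01 : 0 <= t < 1 by apply: powR_l2_lt1; rewrite subr_gt0.
have /andP[t0 t1] := t01.
set K := 1 + (C / l1) `^ b.
have K0 : 0 < K by rewrite ltr_wpDr ?powR_ge0.
exists (K * (1 - t)^-1); first by rewrite mulr_gt0// invr_gt0 subr_gt0.
move=> g sigma a mg rep cy; have [ha hL _ hg] := rep.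
pose B k := lpn P p k (fun Q => normc (sigma Q)).
have B0 k : 0 <= B k by exact: lpn_ge0.
have cE : cost P p q sigma = Lnorm counting q (fun k => (B k)%:E) by [].
have cfin : cost P p q sigma \is a fin_num by rewrite ge0_fin_numE ?cE ?Lnorm_ge0.
have BM k : B k <= fine (cost P p q sigma).
  by rewrite -lee_fin fineK// cE le_Lnorm_counting.
have M0 := le_trans (B0 0%N) (BM 0%N).
have [S [A [repS le_]]] := @hoelder_to_souza _ _ _ _ _ _ _ _ hG _ _ _ _ _ _
  d_gt0 C_ge0 d_vol (ltW (lt_trans s0 sb)) (ltW sb) sigma a ha g
  ((1 - t)^-1 * fine (cost P p q sigma)) p_ge1 s0 mg
  (fun k => (hL k).1) hg (fun j => gconv_le j t01 M0 BM).
exists S, A; split => //; rewrite cE.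
apply: (Lnorm_gconv_le q1 t01 (ltW K0) _ B0 le_) => k; exact: lpn_ge0.
Qed.

Lemma atomic_rep_souza_hoelder s b g S A :
  atomic_rep m P (souza m s p) p g S A ->
  atomic_rep m P (hoelder_atom m d D s b p) p g S A.
Proof. by move=> [hA ? ? ?]; split => // k Q /hA; exact: souza_hoelder. Qed.

Lemma besov_souza_hoelder s b q : 0 < s -> s < b -> (1 <= q)%E ->
  besov m setT P (souza m s p) p q = besov m setT P (hoelder_atom m d D s b p) p q.
Proof.
move=> s0 sb q1; apply/seteqP; split => g [gLp g0 [S [A [rep cy]]]].
  split; [exact: gLp|exact: g0|exists S, A; split; last exact: cy].
  exact: atomic_rep_souza_hoelder rep.
have [kappa kappa0 H] := hoelder_souza_cost s0 sb q1.
have [S' [A' [rep' le_]]] := H _ _ _ gLp.1 rep cy.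
split; [exact: gLp|exact: g0|exists S', A'; split; first exact: rep'].
apply: (le_lt_trans le_).
by rewrite lte_mul_pinfty// ?lee_fin ?(ltW kappa0).
Qed.

Lemma besov_norm_equivalent s b q : 0 < s -> s < b -> (1 <= q)%E ->
  norms_equivalent (besov m setT P (souza m s p) p q)
    (besov_norm m P (souza m s p) p q)
    (besov_norm m P (hoelder_atom m d D s b p) p q).
Proof.
move=> s0 sb q1; have [kappa kappa0 H] := hoelder_souza_cost s0 sb q1.
(* Re-expanding into Souza atoms costs the factor [kappa]; the other inequality has constant 1
   because Souza atoms are Hoelder atoms. *)
exists kappa^-1, 1; split; [by rewrite invr_gt0|exact: ltr01|].
move=> g [[mg _] _ _]; apply/andP; split.
  apply/ereal_infP => _ [S [A [rep cy ->]]].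
  have [S' [A' [rep' le_]]] := H _ _ _ mg rep cy.
  rewrite lee_pdivrMl//; apply: (le_trans _ le_); apply: ereal_inf_lbound.
  exists S', A'; split; [exact: rep'| |by []].
  apply: (le_lt_trans le_).
  by rewrite lte_mul_pinfty// ?lee_fin ?(ltW kappa0).
rewrite mul1e; apply/ereal_infP => _ [S [A [rep cy ->]]].
apply: ereal_inf_lbound; exists S, A; split; [|exact: cy|by []].
exact: atomic_rep_souza_hoelder rep.
Qed.

End BesovSpaces.

Theorem proposition16p2 (disp : measure_display) (T : measurableType disp)
  (R : realType) (m : {finite_measure set T -> \bar R})
  (l1 l2 : R) (P : nat -> set (set T)) (hP : good_grid m l1 l2 P)
  (d : T -> T -> R) (hd : quasi_distance d)
  (hbd : forall k Q, P k Q -> d_bounded d Q)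
  (l3 l4 : R) (hl3 : 0 < l3 < 1) (hl4 : 0 < l4 < 1)
  (hdiam : forall k W Q, P k.+1 W -> P k Q -> W `<=` Q ->
     l3 <= diam d W / diam d Q <= l4)
  (C D : R) (hC : 0 <= C) (hD : 0 <= D)
  (hvol : forall k Q, P k Q ->
     C `^ (- D) * vol m Q <= diam d Q `^ D <= C `^ D * vol m Q)
  (p : R) (hp : 1 <= p)
  (q qt : \bar R) (hq : (1 <= q)%E) (hqt : (1 <= qt)%E)
  (s b bt : R) (hs0 : 0 < s) (hsp : s < p^-1) (hsb : s < b) (hbbt : b < bt) :
  [/\ exists2 c : R, 0 < c & forall k Q, P k Q ->
        scale_set c (hoelder_atom m d D s bt p Q)
          `<=` besov_atom m P l2 s b p qt k Q,
      exists2 c' : R, 0 < c' & forall k Q, P k Q ->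
        scale_set c' (hoelder_atom m d D s b p Q)
          `<=` besov_atom m P l2 s b p +oo%E k Q,
      besov m setT P (souza m s p) p q
        = besov m setT P (hoelder_atom m d D s bt p) p q,
      besov m setT P (hoelder_atom m d D s bt p) p q
        = besov m setT P (hoelder_atom m d D s b p) p q &
      norms_equivalent (besov m setT P (souza m s p) p q)
          (besov_norm m P (souza m s p) p q)
          (besov_norm m P (hoelder_atom m d D s bt p) p q)
      /\ norms_equivalent (besov m setT P (souza m s p) p q)
          (besov_norm m P (souza m s p) p q)
          (besov_norm m P (hoelder_atom m d D s b p) p q)].
Proof.
have hG := cells_good_grid hP; have [d0 dE _ _] := hd.
have d_gt0 x y : x <> y -> 0 < d x y.
  by move=> xy; rewrite lt0r d0 andbT; apply/eqP => /dE.
(* [C]^ D[takes the place of the constant]C[of the preceding sections, where]d x y [^ D] is bounded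
   by [C] times the volume. *)
have CD0 : 0 <= C `^ D by exact: powR_ge0.
have d_vol k Q x y : P k Q -> Q x -> Q y -> d x y `^ D <= C `^ D * vol m Q.
  move=> PQ; have /andP[_ vQ] := hvol _ _ PQ.
  exact: (powR_dist_le_vol d0 (hbd _ _ PQ) hD vQ PQ).
have K_gt0 r : 0 < 1 + (C `^ D / l1) `^ r by rewrite ltr_wpDr ?powR_ge0.
have hsbt := lt_trans hsb hbbt.
split.
(* The gap [b < bt] makes the kernel summable, so any exponent [qt] is admissible. *)
- set t := l2 `^ (bt - b).
  have t01 : 0 <= t < 1 by apply: (powR_l2_lt1 hG); rewrite subr_gt0.
  have t1 : 0 < (1 - t)^-1 by case/andP: t01 => _ ?; rewrite invr_gt0 subr_gt0.
  apply: (hoelder_sub_besov_atom hG d_gt0 CD0 d_vol hp hs0 hsb (ltW hbbt) hqt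
    (mulr_gt0 (K_gt0 bt) t1)) => S c c0 S0 Sle.
  have B0 k : 0 <= (if k is 0%N then c else 0) by case: k.
  apply: (le_trans (Lnorm_gconv_le hqt t01 (ltW (K_gt0 bt)) S0 B0 Sle)).
  rewrite [leRHS]EFinM lee_wpmul2l ?lee_fin ?(ltW (mulr_gt0 (K_gt0 bt) t1))//.
  exact: Lnorm_counting_root_le.
(* With equal smoothness the ratio is 1: the convolution of [c, 0, 0, ...] is constantly [c],
   bounded but without decay. *)
- apply: (hoelder_sub_besov_atom hG d_gt0 CD0 d_vol hp hs0 hsb (lexx b) _
    (K_gt0 b)) => [|S c c0 S0 Sle]; first exact: leey.
  rewrite unlock counting_setT_gt0; apply/ess_supP/aeW => k /=.
  rewrite ger0_norm// lee_fin (le_trans (Sle k))// ler_wpM2l ?(ltW (K_gt0 b))//.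
  rewrite subrr powRr0; elim: k => [|k IH]; first by rewrite gconv0.
  by rewrite gconvS addr0 mul1r.
- exact: (besov_souza_hoelder hG d_gt0 CD0 d_vol hp hs0 hsbt hq).
- rewrite -(besov_souza_hoelder hG d_gt0 CD0 d_vol hp hs0 hsbt hq).
  exact: (besov_souza_hoelder hG d_gt0 CD0 d_vol hp hs0 hsb hq).
split.
- exact: (besov_norm_equivalent hG d_gt0 CD0 d_vol hp hs0 hsbt hq).
- exact: (besov_norm_equivalent hG d_gt0 CD0 d_vol hp hs0 hsb hq).
Qed.
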